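(* Let $A\in\mathbb{R}^{m\times n}$ ($m<n$) and $M\in\mathbb{R}^{m\times q}$ ($m\le q$) with $\mathrm{rank}(A)=\mathrm{rank}(M)=m$, let $y\in\mathbb{R}^m$ and $\mu>0$ be given, and let $\phi$ be a norm on $\mathbb{R}^q$ with $\phi(\mathbf e_i)=\phi^*(\mathbf e_i)=1$ for $i=1,\dots,q$. Consider the problem $$(\mathrm{L})\qquad\min_x\{\phi(M^T(Ax-y)):\ \|x\|_1\le\mu\}.$$ Let $\delta>0$ be any fixed small constant, and let $\mathcal Q_{\epsilon_{j_0}}$ be a fixed polytope from the family $\{\mathcal Q_{\epsilon_j}\}$ defined in the context such that $d^{\mathcal H}(\Lambda^*,\Lambda_{\epsilon_{j_0}})\le\delta$. Suppose that one of the following conditions holds: (a) $A$ (with $\ell_2$-normalized columns) satisfies the mutual coherence property $\mu_1(k)+\mu_1(k-1)<1$; (b) RIP of order $2k$ with constant $\delta_{2k}<1/\sqrt2$; (c) stable NSP of order $k$ with constant $\rho\in(0,1)$; (d) robust NSP of order $k$ with constants $\rho'\in(0,1)$ and $\rho''>0$; (e) NSP of order $k$; (f) RSP of order $k$ of $A^T$. Let $$c=\max_{G\subseteq\{1,\dots,q\},\,|G|=m}\{\|M_G^{-1}(AA^T)^{-1}A\|_{\infty\to1}:\ M_G\in\mathbb{R}^{m\times m}\text{ is an invertible submatrix of }M\},$$ and let $\widehat\gamma=\sigma_{\infty,2}(\widehat M^1,\widehat M^2)$ be the Robinson's constant of the pair $(\widehat M^1,\widehat M^2)$ defined in the context. Then: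 (i) For any $x\in\mathbb{R}^n$ with $\|x\|_1<\mu$ there is an optimal solution $x^*$ of $(\mathrm{L})$ with $$\|x-x^*\|_2\le\delta+2\widehat\gamma\left[2\phi(M^T(Ax-y))+\frac{|\mu-\|x\|_1|+2\sigma_k(x)_1}{c}\right].$$ (ii) For any $x\in\mathbb{R}^n$ with $\|x\|_1=\mu$ there is an optimal solution $x^*$ of $(\mathrm{L})$ with $$\|x-x^*\|_2\le\delta+4\widehat\gamma\left[\phi(M^T(Ax-y))+\frac{\sigma_k(x)_1}{c}\right].$$
   Context: Notation: $\mathbf e_i$ are the standard basis vectors of $\mathbb{R}^q$; $\phi^*(u)=\max_{\phi(x)\le1}u^Tx$ is the dual norm; $\sigma_k(x)_1=\inf_u\{\|x-u\|_1:\|u\|_0\le k\}$, where $\|u\|_0$ is the number of nonzero entries; $M_G$ is the submatrix of $M$ consisting of columns indexed by $G$; $\|Q\|_{\infty\to1}=\max_{\|x\|_\infty\le1}\|Qx\|_1$; for $S\subseteq\{1,\dots,n\}$, $\overline S$ is its complement and $\zeta_S$ the subvector of $\zeta$ indexed by $S$; $d^{\mathcal H}(\Omega_1,\Omega_2)=\max\{\sup_{u\in\Omega_1}\inf_{z\in\Omega_2}\|u-z\|_2,\ \sup_{z\in\Omega_2}\inf_{u\in\Omega_1}\|u-z\|_2\}$ is the Hausdorff distance. Matrix conditions. Mutual coherence: for $A$ with $\ell_2$-normalized columns $a_1,\dots,a_n$, $\mu_1(k)=\max_{i}\max\{\sum_{j\in S}|a_i^Ta_j|:\ S\subseteq\{1,\dots,n\},\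 |S|=k,\ i\notin S\}$ (with $1\le k\le n-1$, and $\mu_1(0)=0$). RIP of order $k$ with constant $\delta_k\in(0,1)$: $(1-\delta_k)\|x\|_2^2\le\|Ax\|_2^2\le(1+\delta_k)\|x\|_2^2$ for all $k$-sparse $x$ (at most $k$ nonzero entries). NSP of order $k$: $\|\zeta_S\|_1<\|\zeta_{\overline S}\|_1$ for all $\zeta\ne0$ with $A\zeta=0$ and all $|S|\le k$. Stable NSP of order $k$ with constant $\rho\in(0,1)$: $\|\zeta_S\|_1\le\rho\|\zeta_{\overline S}\|_1$ for all $\zeta\neq 0$ with $A\zeta=0$ and all $|S|\le k$. Robust NSP of order $k$ with constants $\rho'\in(0,1)$, $\rho''>0$: $\|\zeta_S\|_1\le\rho'\|\zeta_{\overline S}\|_1+\rho''\|A\zeta\|$ for all $\zeta\in\mathbb{R}^n$ and all $|S|\le k$, where $\|\cdot\|$ is a norm on $\mathbb{R}^m$. RSP of order $k$ of $A^T$: for any disjoint $S_1,S_2\subseteq\{1,\dots,n\}$ with $|S_1|+|S_2|\le k$ there exists $\zeta\in\mathcal{R}(A^T)$ (the range of $A^T$) with $\zeta_i=1$ for $i\in S_1$, $\zeta_i=-1$ for $i\in S_2$, and $|\zeta_i|<1$ for $i\notin S_1\cup S_2$. Polytopes $\mathcal Q_{\epsilon_j}$: let $\mathfrak B^\phi=\{x\in\mathbb{R}^q:\phi(x)\le1\}$. Fix $\chi>e/(4\sqrt2)$. By a theorem of Barvinok there is $\epsilon_0=\epsilon_0(\chi)>0$ such that for each $0<\epsilon<\epsilon_0$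 there is a symmetric polytope $P_\epsilon\subset\mathbb{R}^q$ with at most $\left(\frac{\chi}{\sqrt\epsilon}\ln\frac1\epsilon\right)^q$ vertices and $P_\epsilon\subseteq\mathfrak B^\phi\subseteq(1+\epsilon)P_\epsilon$; fix such $P_\epsilon$. Shifting each facet hyperplane of $(1+\epsilon)P_\epsilon$ in parallel toward $\mathfrak B^\phi$ until it touches $\mathfrak B^\phi$ gives a polytope $\widehat P_\epsilon=\bigcap_{i=1}^J\{x:(a^i)^Tx\le1\}$, where the $a^i$ are the outer facet normals of $(1+\epsilon)P_\epsilon$ scaled so that $\phi^*(a^i)=1$. Put $\overline P_\epsilon=\widehat P_\epsilon\cap\{z\in\mathbb{R}^q:\ \mathbf e_i^Tz\le1,\ -\mathbf e_i^Tz\le1,\ i=1,\dots,q\}$. Fix a strictly decreasing positive sequence $\epsilon_k\in(0,\epsilon_0)$ with $\epsilon_k\to0$, and set $\mathcal Q_{\epsilon_j}=\bigcap_{k=1}^j\overline P_{\epsilon_k}$. Then $P_{\epsilon_j}\subseteq\mathfrak B^\phi\subseteq\mathcal Q_{\epsilon_j}\subseteq(1+\epsilon_j)P_{\epsilon_j}$. Let $\mathcal Y(\Gamma_{\mathcal Q_{\epsilon_j}})$ be the finite set of all vectors $a$ (each with $\phi^*(a)=1$) defining the half-spaces $a^Tz\le1$ in this construction of $\mathcal Q_{\epsilon_j}$ (including $\pm\mathbf e_i$), and $\Gamma_{\mathcal Q_{\epsilon_j}}$ the matrix with these vectors as columns, so that $\mathcal Q_{\epsilon_j}=\{z:(\Gamma_{\mathcal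 Q_{\epsilon_j}})^Tz\le\text{vector of ones}\}$. Solution set and relaxations: let $\rho^*$ be the optimal value of $(\mathrm L)$, $\Lambda^*=\{x\in\mathbb{R}^n:\|x\|_1\le\mu,\ \phi(M^T(Ax-y))\le\rho^*\}$ its set of optimal solutions, and $\Lambda_{\epsilon_j}=\{x\in\mathbb{R}^n:\|x\|_1\le\mu,\ a^TM^T(Ax-y)\le\rho^*\text{ for all }a\in\mathcal Y(\Gamma_{\mathcal Q_{\epsilon_j}})\}$. (One has $d^{\mathcal H}(\Lambda^*,\Lambda_{\epsilon_j})\to0$ as $j\to\infty$, so a $j_0$ as required exists.) Robinson's constant: for $M'\in\mathbb{R}^{p_1\times r}$, $M''\in\mathbb{R}^{p_2\times r}$ let $$\mu_{\alpha_1,\alpha_2}(M',M'')=\max_{(d',d'')\in\mathcal F,\ \|(d',d'')\|_{\alpha_2}\le1}\ \min_{u\in\mathbb{R}^r}\{\|u\|_{\alpha_1}:\ M'u\le d',\ M''u=d''\},$$ with $\mathcal F=\{(d',d''):\ M'u\le d',\ M''u=d''\text{ for some }u\in\mathbb{R}^r\}$ (this is a finite number). For $N^1\in\mathbb{R}^{m_1\times\ell}$, $N^2\in\mathbb{R}^{m_2\times\ell}$, $$\sigma_{\alpha_1,\alpha_2}(N^1,N^2)=\max_{S\subseteq\{1,\dots,m_1\}}\mu_{\alpha_1,\alpha_2}\left(\begin{bmatrix}I_S&0\\-I&0\end{bmatrix},\begin{bmatrix}N^1\\N^2\end{bmatrix}^T\right),$$ where $I$ is the $m_1\times m_1$ identity,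 $I_S$ consists of the rows of $I$ indexed by $S$, and the first matrix has $m_1+m_2$ columns. The matrices $\widehat M^1,\widehat M^2$: write $\Gamma=\Gamma_{\mathcal Q_{\epsilon_{j_0}}}\in\mathbb{R}^{q\times\widehat n}$, $\widehat n$ being its number of columns; $\widetilde{\mathbf e}\in\mathbb{R}^n$, $\widehat{\mathbf e}\in\mathbb{R}^{\widehat n}$ are vectors of ones, $I$ is the $n\times n$ and $\widehat I$ the $\widehat n\times\widehat n$ identity; block columns have sizes $n,n,1,n,n,1,\widehat n$: $$\widehat M^1=\begin{bmatrix} I&-I&0&0&0&0&0\\ -I&-I&0&0&0&0&0\\ 0&\widetilde{\mathbf e}^T&0&0&0&0&0\\ (M\Gamma)^TA&0&-\widehat{\mathbf e}&0&0&0&0\\ 0&0&0&I&I&-\widetilde{\mathbf e}&0\\ 0&0&0&0&0&0&\widehat{\mathbf e}^T\\ 0&-I&0&0&0&0&0\\ 0&0&-1&0&0&0&0\\ 0&0&0&-I&0&0&0\\ 0&0&0&0&-I&0&0\\ 0&0&0&0&0&-1&0\\ 0&0&0&0&0&0&-\widehat I \end{bmatrix},\qquad \widehat M^2=\begin{bmatrix} 0&0&0&I&-I&0&A^TM\Gamma\\ 0&0&1&0&0&\mu&y^TM\Gamma \end{bmatrix}.$$ *)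

(* Defs.v *)
From HB Require Import structures.
From mathcomp Require Import all_boot all_order all_algebra.
From mathcomp Require Import all_classical all_reals all_analysis.

Set Implicit Arguments.
Unset Strict Implicit.
Unset Printing Implicit Defensive.

Import Order.TTheory GRing.Theory Num.Theory.
Import numFieldNormedType.Exports.

Local Open Scope classical_set_scope.
Local Open Scope ring_scope.

(* Every "max" / "min" over a set of reals is written with [sup] / [inf]; in
   all uses below the set is nonempty and bounded, so that no default value of
   [sup] or [inf] is involved. *)

Section VectorNorms.
Context {R : realType}.

Definition dotv {n} (u v : 'cV[R]_n) : R := (u^T *m v) 0 0.

Definition e_ {n} (i : 'I_n) : 'cV[R]_n := delta_mx i 0.

Definition l0norm {n} (x : 'cV[R]_n) : nat := #|[set i | x i 0 != 0]%SET|.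

Definition l1norm {n} (x : 'cV[R]_n) : R := \sum_i `|x i 0|.

Definition l2norm {n} (x : 'cV[R]_n) : R := Num.sqrt (\sum_i (x i 0) ^+ 2).

Definition linfnorm {n} (x : 'cV[R]_n) : R := mx_norm x.

Definition l1norm_on {n} (S : {set 'I_n}) (x : 'cV[R]_n) : R :=
  \sum_(i in S) `|x i 0|.

Definition vle {n} (u v : 'cV[R]_n) : Prop := forall i, u i 0 <= v i 0.

Definition is_norm {n} (phi : 'cV[R]_n -> R) : Prop :=
  [/\ forall x, 0 <= phi x,
      forall x, phi x = 0 -> x = 0,
      forall (a : R) x, phi (a *: x) = `|a| * phi x
    & forall x y, phi (x + y) <= phi x + phi y].

Definition unit_ball {n} (phi : 'cV[R]_n -> R) : set 'cV[R]_n :=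
  [set x | phi x <= 1].

Definition dual_norm {n} (phi : 'cV[R]_n -> R) (u : 'cV[R]_n) : R :=
  sup [set dotv u x | x in unit_ball phi].

Definition sigma1 {n} (k : nat) (x : 'cV[R]_n) : R :=
  inf [set l1norm (x - u) | u in [set u | (l0norm u <= k)%N]].

Definition norm_inf_1 {m n} (Q : 'M[R]_(m, n)) : R :=
  sup [set l1norm (Q *m x) | x in unit_ball linfnorm].

(* Valued in the extended reals, so that it is meaningful for all sets. *)
Definition hausdorff_dist {n} (U V : set 'cV[R]_n) : \bar R :=
  maxe
    (ereal_sup [set ereal_inf [set (l2norm (u - z))%:E | z in V] | u in U])
    (ereal_sup [set ereal_inf [set (l2norm (u - z))%:E | u in U] | z in V]).

End VectorNorms.

Section MatrixConditions.
Context {R : realType} {m n : nat}.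
Implicit Type A : 'M[R]_(m, n).

Definition normalized_columns A : Prop := forall j, l2norm (col j A) = 1.

(* Meaningful for k <= n - 1 only; for k = 0 its value is 0. *)
Definition mu1 A (k : nat) : R :=
  sup [set t | exists i (S : {set 'I_n}),
        [/\ #|S| = k, i \notin S
          & t = \sum_(j in S) `|dotv (col i A) (col j A)|]].

Definition RIP A (k : nat) (d : R) : Prop :=
  [/\ 0 < d, d < 1 & forall x : 'cV[R]_n, (l0norm x <= k)%N ->
    (1 - d) * l2norm x ^+ 2 <= l2norm (A *m x) ^+ 2 <=
    (1 + d) * l2norm x ^+ 2].

Definition NSP A (k : nat) : Prop :=
  forall z : 'cV[R]_n, z != 0 -> A *m z = 0 ->
  forall S : {set 'I_n}, (#|S| <= k)%N ->
    l1norm_on S z < l1norm_on (~: S)%SET z.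

Definition stable_NSP A (k : nat) (rho : R) : Prop :=
  [/\ 0 < rho, rho < 1 &
    forall z : 'cV[R]_n, z != 0 -> A *m z = 0 ->
    forall S : {set 'I_n}, (#|S| <= k)%N ->
      l1norm_on S z <= rho * l1norm_on (~: S)%SET z].

Definition robust_NSP A (k : nat) (nrm : 'cV[R]_m -> R) (rho1 rho2 : R) : Prop :=
  [/\ is_norm nrm, 0 < rho1, rho1 < 1, 0 < rho2 &
    forall (z : 'cV[R]_n) (S : {set 'I_n}), (#|S| <= k)%N ->
      l1norm_on S z <= rho1 * l1norm_on (~: S)%SET z + rho2 * nrm (A *m z)].

(* The range space property of order k of A^T. *)
Definition RSP_tr A (k : nat) : Prop :=
  forall S1 S2 : {set 'I_n}, (S1 :&: S2)%SET = finset.set0 -> (#|S1| + #|S2| <= k)%N ->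
  exists z : 'cV[R]_n,
    [/\ exists eta : 'cV[R]_m, z = A^T *m eta,
        forall i, i \in S1 -> z i 0 = 1,
        forall i, i \in S2 -> z i 0 = -1
      & forall i, i \notin S1 -> i \notin S2 -> `|z i 0| < 1].

End MatrixConditions.

Section Problem.
Context {R : realType} {m n q : nat}.
Variables (A : 'M[R]_(m, n)) (M : 'M[R]_(m, q)) (y : 'cV[R]_m) (mu : R).
Variable phi : 'cV[R]_q -> R.

Definition objective (x : 'cV[R]_n) : R := phi (M^T *m (A *m x - y)).

Definition feasible (x : 'cV[R]_n) : Prop := l1norm x <= mu.

Definition optimal_solution (x : 'cV[R]_n) : Prop :=
  feasible x /\ forall z, feasible z -> objective x <= objective z.

Definition optimal_value : R := inf [set objective x | x in feasible].

Definition Lambda_opt : set 'cV[R]_n :=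
  [set x | l1norm x <= mu /\ objective x <= optimal_value].

(* The relaxation of [Lambda_opt] given by a set Y of normals. *)
Definition Lambda_relaxed (Y : set 'cV[R]_q) : set 'cV[R]_n :=
  [set x | l1norm x <= mu /\
    forall a, Y a -> dotv a (M^T *m (A *m x - y)) <= optimal_value].

(* The submatrix of M of the columns indexed by G, in increasing order. *)
Definition submx_cols (G : {set 'I_q}) (hG : #|G| = m) : 'M[R]_m :=
  colsub (fun j : 'I_m => enum_val (cast_ord (esym hG) j)) M.

Definition c_const : R :=
  sup [set t | exists (G : {set 'I_q}) (hG : #|G| = m),
        submx_cols hG \in unitmx /\
        t = norm_inf_1 (invmx (submx_cols hG) *m invmx (A *m A^T) *m A)].

End Problem.

Section Polytopes.
Context {R : realType} {q : nat}.
Implicit Types (K : set 'cV[R]_q) (a : 'cV[R]_q).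

Definition conv_hull (s : seq 'cV[R]_q) : set 'cV[R]_q :=
  [set x | exists w : 'I_(size s) -> R,
    [/\ forall i, 0 <= w i, \sum_i w i = 1 & x = \sum_i w i *: s`_i]].

Definition polytope K : Prop := exists s, K = conv_hull s.

Definition symmetric_set K : Prop := forall x, K x -> K (- x).

(* The extreme points; for a polytope, its vertices. *)
Definition vertices K : set 'cV[R]_q :=
  [set v | K v /\ forall x z (t : R), K x -> K z -> 0 < t < 1 ->
    v = t *: x + (1 - t) *: z -> x = v /\ z = v].

Definition dilate (r : R) K : set 'cV[R]_q := [set r *: x | x in K].

Definition exposed_face K a : set 'cV[R]_q :=
  [set x | K x /\ forall z, K z -> dotv a z <= dotv a x].

Definition affinely_independent (v : 'I_q -> 'cV[R]_q) : Prop :=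
  forall w : 'I_q -> R,
    \sum_i w i = 0 -> \sum_i w i *: v i = 0 -> forall i, w i = 0.

(* a is an outer normal of a facet: the face it exposes has dimension q - 1,
   i.e. contains q affinely independent points. *)
Definition facet_normal K a : Prop :=
  a != 0 /\ exists v : 'I_q -> 'cV[R]_q,
    (forall i, exposed_face K a (v i)) /\ affinely_independent v.

Variable phi : 'cV[R]_q -> R.

Definition barvinok_family (chi eps0 : R) (P : R -> set 'cV[R]_q) : Prop :=
  forall eps, 0 < eps -> eps < eps0 ->
  [/\ polytope (P eps), symmetric_set (P eps),
      exists s : seq 'cV[R]_q, vertices (P eps) `<=` [set` s] /\
        (size s)%:R <= (chi / Num.sqrt eps * ln (1 / eps)) ^+ q
    & P eps `<=` unit_ball phi /\ unit_ball phi `<=` dilate (1 + eps) (P eps)].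

(* The sequence starts at index 1; the value eps 0 is irrelevant. *)
Definition tolerance_sequence (eps0 : R) (eps : nat -> R) : Prop :=
  [/\ forall k, (1 <= k)%N -> 0 < eps k < eps0,
      forall k, (1 <= k)%N -> eps k.+1 < eps k
    & eps @ \oo --> (0 : R)].

Variables (P : R -> set 'cV[R]_q) (eps : nat -> R).

Definition shifted_normals (t : R) : set 'cV[R]_q :=
  [set a | facet_normal (dilate (1 + t) (P t)) a /\ dual_norm phi a = 1].

Definition signed_basis : set 'cV[R]_q :=
  [set a | exists i : 'I_q, a = e_ i \/ a = - e_ i].

Definition P_hat (t : R) : set 'cV[R]_q :=
  [set x | forall a, shifted_normals t a -> dotv a x <= 1].

Definition P_bar (t : R) : set 'cV[R]_q :=
  P_hat t `&`
  [set z | forall i : 'I_q, dotv (e_ i) z <= 1 /\ dotv (- e_ i) z <= 1].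

Definition Q_poly (j : nat) : set 'cV[R]_q :=
  \bigcap_(k in [set k | (1 <= k <= j)%N]) P_bar (eps k).

(* The normals of the half-spaces in the construction of [Q_poly j]. *)
Definition Q_normals (j : nat) : set 'cV[R]_q :=
  [set a | (exists k, (1 <= k <= j)%N /\ shifted_normals (eps k) a) \/
           signed_basis a].

Lemma Q_polyE j : (1 <= j)%N ->
  Q_poly j = [set z | forall a, Q_normals j a -> dotv a z <= 1].
Proof.
move=> j1; apply/seteqP; split => z /=.
- move=> Qz a [[k [kj ha]]|[i [->|->]]].
  + by have [+ _] := Qz k kj; exact.
  + by have [_ /(_ i) []] := Qz 1%N j1.
  + by have [_ /(_ i) []] := Qz 1%N j1.
- move=> Qz k kj; split=> [a ha|i]; first by apply: Qz; left; exists k.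
  by split; apply: Qz; right; exists i; [left|right].
Qed.

(* The columns of G enumerate the set Y, without repetition. *)
Definition enumerates_columns {nh} (G : 'M[R]_(q, nh)) (Y : set 'cV[R]_q) :=
  injective (fun i => col i G) /\ range (fun i => col i G) = Y.

End Polytopes.

Section Robinson.
Context {R : realType}.
(* The two norms, one on each space of column vectors. *)
Variables nrm1 nrm2 : forall k : nat, 'cV[R]_k -> R.

Definition solutions {p1 p2 r} (M1 : 'M[R]_(p1, r)) (M2 : 'M[R]_(p2, r))
    (d1 : 'cV[R]_p1) (d2 : 'cV[R]_p2) : set 'cV[R]_r :=
  [set u | vle (M1 *m u) d1 /\ M2 *m u = d2].

Definition robinson_mu {p1 p2 r} (M1 : 'M[R]_(p1, r)) (M2 : 'M[R]_(p2, r)) : R :=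
  sup [set t | exists (d1 : 'cV[R]_p1) (d2 : 'cV[R]_p2),
        [/\ solutions M1 M2 d1 d2 !=set0, nrm2 (col_mx d1 d2) <= 1
          & t = inf [set nrm1 u | u in solutions M1 M2 d1 d2]]].

Definition rows_id {k} (S : {set 'I_k}) : 'M[R]_(#|S|, k) :=
  rowsub enum_val 1%:M.

Definition robinson_sigma {m1 m2 l} (N1 : 'M[R]_(m1, l)) (N2 : 'M[R]_(m2, l)) : R :=
  sup (range (fun S : {set 'I_m1} =>
    robinson_mu (block_mx (rows_id S) 0 (- 1%:M) (0 : 'M[R]_(m1, m2)))
                (col_mx N1 N2)^T)).

End Robinson.

Section HatMatrices.
Context {R : realType} {m n q nh : nat}.
Variables (A : 'M[R]_(m, n)) (M : 'M[R]_(m, q)) (y : 'cV[R]_m) (mu : R).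
Variable G : 'M[R]_(q, nh).

(* A block row with column sizes n, n, 1, n, n, 1, nh. *)
Definition row7 {r} (B1 B2 : 'M[R]_(r, n)) (B3 : 'M[R]_(r, 1))
    (B4 B5 : 'M[R]_(r, n)) (B6 : 'M[R]_(r, 1)) (B7 : 'M[R]_(r, nh)) :=
  row_mx B1 (row_mx B2 (row_mx B3 (row_mx B4 (row_mx B5 (row_mx B6 B7))))).

Definition M1_hat :=
  let I : 'M[R]_n := 1%:M in
  let Ih : 'M[R]_nh := 1%:M in
  let one : 'M[R]_1 := 1%:M in
  let et : 'cV[R]_n := const_mx 1 in
  let eh : 'cV[R]_nh := const_mx 1 in
  col_mx (row7 I (- I) 0 0 0 0 0)
 (col_mx (row7 (- I) (- I) 0 0 0 0 0)
 (col_mx (row7 0 et^T 0 0 0 0 0)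
 (col_mx (row7 ((M *m G)^T *m A) 0 (- eh) 0 0 0 0)
 (col_mx (row7 0 0 0 I I (- et) 0)
 (col_mx (row7 0 0 0 0 0 0 eh^T)
 (col_mx (row7 0 (- I) 0 0 0 0 0)
 (col_mx (row7 0 0 (- one) 0 0 0 0)
 (col_mx (row7 0 0 0 (- I) 0 0 0)
 (col_mx (row7 0 0 0 0 (- I) 0 0)
 (col_mx (row7 0 0 0 0 0 (- one) 0)
         (row7 0 0 0 0 0 0 (- Ih)))))))))))).

Definition M2_hat :=
  col_mx (row7 0 0 0 1%:M (- 1%:M) 0 (A^T *m M *m G))
         (row7 0 0 1%:M 0 0 (mu%:M) (y^T *m M *m G)).

Definition gamma_hat : R :=
  robinson_sigma (@linfnorm R) (@l2norm R) M1_hat M2_hat.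

End HatMatrices.

(* Main.v *)
(* Each of (a)-(f) yields the weak range space property: any sign pattern on at
   most k coordinates extends to some A^T eta with entries in [-1, 1].  For (a)-(e)
   this is Farkas' lemma applied to |z_S|_1 <= |z_{~S}|_1 on ker A; for (b) this
   null space inequality comes from a quadratic comparison of Cai and Zhang type.
   Replacing phi(z) <= rho by a^T z <= rho for the normals a gives a linear program;
   the pairs of a solution of it and of a solution of its dual form the polyhedron
   {M1_hat z <= rhs1_hat, M2_hat z = 0}, where the last row of the equation says that
   the duality gap vanishes.  A given x is completed to a point z all of whose
   residuals vanish except the duality gap: the dual part is -eta / c written as a
   nonnegative combination of the columns of M Gamma, and c is exactly what bounds
   the total weight by 1.  The gap is then at most
   2 phi(M^T(Ax - y)) + (mu - |x|_1 + 2 sigma_k(x)_1) / c, Robinson's constant turns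
   it into a distance to the polyhedron, and the Hausdorff bound leads from the
   relaxed solution set to the set of optimal solutions. *)

Require Import Defs.
From HB Require Import structures.
From mathcomp Require Import all_boot all_order all_algebra.
From mathcomp Require Import all_classical all_reals all_analysis.
From mathcomp Require Import ring lra.

Import Order.TTheory GRing.Theory Num.Theory.
Import numFieldNormedType.Exports.

Local Open Scope classical_set_scope.
Local Open Scope ring_scope.

(** A supremum over an unbounded set is 0 by default, so it bounds its elements only once
    boundedness has been shown. For Robinson's constant this takes a Hoffman-type estimate proved
    beforehand, [polyhedron_small_point]. The shape of [c] comes from lifting multipliers:
    [invmx (A *m A^T) *m A] recovers [eta] from [A^T *m eta], and inverting m columns of [M] writes
    [- eta] as [M *m h] with |h|_1 at most [c]. Since e_i and -e_i are among the columns of [Gamma],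
    |h|_1 becomes the total weight of a nonnegative combination. For (b), the tail of a null vector
    is replaced by a k-sparse vector that is at least as bad for the single functional g = A^T A x,
    x being the head. One inner product thus carries all the information, and the restricted
    isometry is only applied to 2k-sparse vectors. *)

(** * Inner products and norms of column vectors *)

Lemma dotvE {R : realType} {n} (u v : 'cV[R]_n) :
  dotv u v = \sum_i u i 0 * v i 0.
Proof. by rewrite /dotv mxE; apply: eq_bigr => i _; rewrite mxE. Qed.

Lemma dotvC {R : realType} {n} (u v : 'cV[R]_n) : dotv u v = dotv v u.
Proof. by rewrite !dotvE; apply: eq_bigr => i _; rewrite mulrC. Qed.

Lemma dotvDl {R : realType} {n} (u v w : 'cV[R]_n) :
  dotv (u + v) w = dotv u w + dotv v w.
Proof. by rewrite /dotv linearD mulmxDl mxE. Qed.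

Lemma dotvNl {R : realType} {n} (u v : 'cV[R]_n) : dotv (- u) v = - dotv u v.
Proof. by rewrite /dotv linearN mulNmx mxE. Qed.

Lemma dotvZl {R : realType} {n} (a : R) (u v : 'cV[R]_n) :
  dotv (a *: u) v = a * dotv u v.
Proof. by rewrite /dotv linearZ /= -scalemxAl mxE. Qed.

Lemma dotv0l {R : realType} {n} (v : 'cV[R]_n) : dotv 0 v = 0.
Proof. by rewrite /dotv trmx0 mul0mx mxE. Qed.

Lemma dotvDr {R : realType} {n} (u v w : 'cV[R]_n) :
  dotv u (v + w) = dotv u v + dotv u w.
Proof. by rewrite /dotv mulmxDr mxE. Qed.

Lemma dotvNr {R : realType} {n} (u v : 'cV[R]_n) : dotv u (- v) = - dotv u v.
Proof. by rewrite /dotv mulmxN mxE. Qed.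

Lemma dotvZr {R : realType} {n} (a : R) (u v : 'cV[R]_n) :
  dotv u (a *: v) = a * dotv u v.
Proof. by rewrite /dotv -scalemxAr mxE. Qed.

Lemma dotv0r {R : realType} {n} (u : 'cV[R]_n) : dotv u 0 = 0.
Proof. by rewrite /dotv mulmx0 mxE. Qed.

Lemma dotv_mulmx {R : realType} {m n} (B : 'M[R]_(m, n)) u v :
  dotv u (B *m v) = dotv (B^T *m u) v.
Proof. by rewrite /dotv trmx_mul trmxK mulmxA. Qed.

Lemma dotv_col_mx {R : realType} {m n} (a c : 'cV[R]_m) (b d : 'cV[R]_n) :
  dotv (col_mx a b) (col_mx c d) = dotv a c + dotv b d.
Proof. by rewrite /dotv tr_col_mx mul_row_col mxE. Qed.

Lemma mulmx_dotv {R : realType} {m n} (B : 'M[R]_(m, n)) (v : 'cV[R]_n) i :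
  (B *m v) i 0 = dotv (row i B)^T v.
Proof. by rewrite /dotv trmxK -row_mul [RHS]mxE. Qed.

Lemma dotvv_ge0 {R : realType} {n} (u : 'cV[R]_n) : 0 <= dotv u u.
Proof. by rewrite dotvE sumr_ge0 // => i _; rewrite -expr2 sqr_ge0. Qed.

Lemma l2norm_ge0 {R : realType} {n} (u : 'cV[R]_n) : 0 <= l2norm u.
Proof. exact: sqrtr_ge0. Qed.

Lemma sqr_l2norm {R : realType} {n} (u : 'cV[R]_n) : l2norm u ^+ 2 = dotv u u.
Proof.
rewrite /l2norm sqr_sqrtr; last by rewrite sumr_ge0 // => i _; rewrite sqr_ge0.
by rewrite dotvE.
Qed.

Lemma dotvv_eq0 {R : realType} {n} (u : 'cV[R]_n) : dotv u u = 0 -> u = 0.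
Proof.
move=> /eqP; rewrite dotvE psumr_eq0 => [/allP h|i _]; last first.
  by rewrite -expr2 sqr_ge0.
apply/colP => i; have /h /implyP /(_ isT) : i \in index_enum 'I_n.
  exact: mem_index_enum.
by rewrite mulf_eq0 orbb mxE => /eqP.
Qed.

Lemma l2norm0 {R : realType} {n} : l2norm (0 : 'cV[R]_n) = 0.
Proof. by apply/eqP; rewrite -sqrf_eq0 sqr_l2norm dotv0l. Qed.

Lemma l2normZ {R : realType} {n} (a : R) (u : 'cV[R]_n) :
  l2norm (a *: u) = `|a| * l2norm u.
Proof.
apply/eqP; rewrite -(eqrXn2 (n := 2)) // ?l2norm_ge0 ?mulr_ge0 ?l2norm_ge0 //.
by rewrite exprMn !sqr_l2norm dotvZl dotvZr real_normK ?num_real // mulrA.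
Qed.

Lemma l2norm_distC {R : realType} {n} (u v : 'cV[R]_n) :
  l2norm (u - v) = l2norm (v - u).
Proof. by rewrite -opprB -scaleN1r l2normZ normrN1 mul1r. Qed.

Lemma l2norm_col_mx0 {R : realType} {m n} (b : 'cV[R]_n) :
  l2norm (col_mx (0 : 'cV[R]_m) b) = l2norm b.
Proof.
apply/eqP; rewrite -(eqrXn2 (n := 2)) // ?l2norm_ge0 // !sqr_l2norm.
by rewrite dotv_col_mx dotv0l add0r.
Qed.

Lemma l2norm_col_mx_ge {R : realType} {m n} (a : 'cV[R]_m) (b : 'cV[R]_n) :
  l2norm a <= l2norm (col_mx a b).
Proof.
rewrite -(ler_pXn2r (n := 2)) ?nnegrE ?l2norm_ge0 // !sqr_l2norm dotv_col_mx.
by rewrite lerDl dotvv_ge0.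
Qed.

Lemma cauchy_schwarz {R : realType} {n} (u v : 'cV[R]_n) :
  dotv u v <= l2norm u * l2norm v.
Proof.
have h : dotv u v ^+ 2 <= (l2norm u * l2norm v) ^+ 2.
  rewrite exprMn !sqr_l2norm.
  have [v0|v_neq0] := eqVneq (dotv v v) 0.
    by rewrite (dotvv_eq0 _ v0) !dotv0r expr0n mulr0.
  have v_gt0 : 0 < dotv v v by rewrite lt_def v_neq0 dotvv_ge0.
  (* The square of this vector is [dotv v v] times the defect in the inequality. *)
  have := dotvv_ge0 (dotv v v *: u - dotv u v *: v).
  rewrite !(dotvDl, dotvDr, dotvNl, dotvNr, dotvZl, dotvZr) (dotvC v u) => h.
  rewrite -subr_ge0 -(pmulr_rge0 _ v_gt0).
  by apply: le_trans h _; rewrite le_eqVlt; apply/orP; left; apply/eqP; ring.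
apply: le_trans (ler_norm _) _.
rewrite -(ler_pXn2r (n := 2)) ?nnegrE ?mulr_ge0 ?l2norm_ge0 //.
by rewrite real_normK ?num_real.
Qed.

Lemma l2norm_triangle {R : realType} {n} (u v : 'cV[R]_n) :
  l2norm (u + v) <= l2norm u + l2norm v.
Proof.
rewrite -(ler_pXn2r (n := 2)) ?nnegrE ?addr_ge0 ?l2norm_ge0 //.
rewrite sqr_l2norm sqrrD !sqr_l2norm !(dotvDl, dotvDr) (dotvC v u).
by have := cauchy_schwarz u v; lra.
Qed.

Lemma l1norm_ge0 {R : realType} {n} (u : 'cV[R]_n) : 0 <= l1norm u.
Proof. by rewrite sumr_ge0. Qed.

Lemma l1norm0 {R : realType} {n} : l1norm (0 : 'cV[R]_n) = 0.
Proof. by rewrite /l1norm big1 // => i _; rewrite mxE normr0. Qed.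

Lemma l1normN {R : realType} {n} (u : 'cV[R]_n) : l1norm (- u) = l1norm u.
Proof. by apply: eq_bigr => i _; rewrite mxE normrN. Qed.

Lemma l1normZ {R : realType} {n} (a : R) (u : 'cV[R]_n) :
  l1norm (a *: u) = `|a| * l1norm u.
Proof. by rewrite /l1norm mulr_sumr; apply: eq_bigr => i _; rewrite mxE normrM. Qed.

Lemma l1norm_triangle {R : realType} {n} (u v : 'cV[R]_n) :
  l1norm (u + v) <= l1norm u + l1norm v.
Proof.
by rewrite /l1norm -big_split /=; apply: ler_sum => i _; rewrite mxE ler_normD.
Qed.

Lemma normr_le_l1norm {R : realType} {n} (u : 'cV[R]_n) i : `|u i 0| <= l1norm u.
Proof. by rewrite /l1norm (bigD1 i) //= lerDl sumr_ge0. Qed.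

Lemma normr_le_l2norm {R : realType} {n} (u : 'cV[R]_n) i : `|u i 0| <= l2norm u.
Proof.
rewrite -(ler_pXn2r (n := 2)) ?nnegrE ?l2norm_ge0 // sqr_l2norm.
rewrite real_normK ?num_real // dotvE (bigD1 i) //= -expr2 lerDl sumr_ge0 // => j _.
by rewrite -expr2 sqr_ge0.
Qed.

Lemma l2norm_le_l1norm {R : realType} {n} (u : 'cV[R]_n) : l2norm u <= l1norm u.
Proof.
rewrite -(ler_pXn2r (n := 2)) ?nnegrE ?l2norm_ge0 ?l1norm_ge0 // sqr_l2norm.
rewrite dotvE expr2 {2}/l1norm mulr_sumr; apply: ler_sum => i _.
rewrite -expr2 -real_normK ?num_real // expr2 ler_wpM2r //.
exact: normr_le_l1norm.
Qed.

Lemma dotv_le_l1norm {R : realType} {n} (u v : 'cV[R]_n) (c : R) :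
  (forall i, `|u i 0| <= c) -> `|dotv u v| <= c * l1norm v.
Proof.
move=> uc; rewrite dotvE; apply: le_trans (ler_norm_sum _ _ _) _.
by rewrite /l1norm mulr_sumr; apply: ler_sum => i _; rewrite normrM ler_wpM2r.
Qed.

Lemma linfnorm_ge0 {R : realType} {n} (u : 'cV[R]_n) : 0 <= linfnorm u.
Proof. by rewrite /linfnorm mx_normE. Qed.

Lemma normr_le_linfnorm {R : realType} {n} (u : 'cV[R]_n) i :
  `|u i 0| <= linfnorm u.
Proof.
rewrite /linfnorm mx_normrE; apply/bigmax_geP; right => /=.
by exists (i, ord0) => //=; rewrite lexx.
Qed.

Lemma linfnorm_le {R : realType} {n} (u : 'cV[R]_n) (c : R) :
  0 <= c -> (forall i, `|u i 0| <= c) -> linfnorm u <= c.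
Proof.
move=> c0 uc; rewrite /linfnorm mx_normrE; apply/bigmax_leP; split=> // -[i j] _.
by rewrite (ord1 j).
Qed.

Lemma vle_col_mx {R : realType} {m n} (a c : 'cV[R]_m) (b d : 'cV[R]_n) :
  vle (col_mx a b) (col_mx c d) <-> vle a c /\ vle b d.
Proof.
split=> [h|[h1 h2] i].
  split=> i; first by have := h (lshift n i); rewrite !col_mxEu.
  by have := h (rshift m i); rewrite !col_mxEd.
by case: (split_ordP i) => j ->; rewrite ?(col_mxEu, col_mxEd).
Qed.

Lemma vle_col_mx0 {R : realType} {m n} (a : 'cV[R]_m) (b : 'cV[R]_n) :
  vle (col_mx a b) 0 <-> vle a 0 /\ vle b 0.
Proof. by rewrite -vle_col_mx col_mx0. Qed.

Lemma vle0_col_mx {R : realType} {m n} (a : 'cV[R]_m) (b : 'cV[R]_n) :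
  vle 0 (col_mx a b) <-> vle 0 a /\ vle 0 b.
Proof. by rewrite -vle_col_mx col_mx0. Qed.

Lemma l1norm_col_mx {R : realType} {m n} (a : 'cV[R]_m) (b : 'cV[R]_n) :
  l1norm (col_mx a b) = l1norm a + l1norm b.
Proof.
rewrite /l1norm big_split_ord; congr (_ + _); apply: eq_bigr => i _.
  by rewrite col_mxEu.
by rewrite col_mxEd.
Qed.

Lemma dotv_ge0 {R : realType} {n} (u v : 'cV[R]_n) :
  vle 0 u -> vle 0 v -> 0 <= dotv u v.
Proof.
move=> u0 v0; rewrite dotvE sumr_ge0 // => i _; apply: mulr_ge0.
  by have := u0 i; rewrite mxE.
by have := v0 i; rewrite mxE.
Qed.

Lemma dotv_le {R : realType} {n} (u v w : 'cV[R]_n) :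
  vle 0 u -> vle v w -> dotv u v <= dotv u w.
Proof.
move=> u0 vw; rewrite -subr_ge0 -dotvNr -dotvDr dotv_ge0 // => i.
by rewrite !mxE subr_ge0.
Qed.

(** * Farkas' lemma *)

(* Bartl's elimination: if the last inequality cannot be dropped, a point [x0]
   violating the conclusion is used to project along [x0] onto the kernel of the
   last functional. *)
Lemma farkas_seq {R : realType} r p (a : nat -> 'cV[R]_r) (g : 'cV[R]_r) :
  (forall x, (forall i, (i < p)%N -> dotv (a i) x <= 0) -> dotv g x <= 0) ->
  exists l : nat -> R, (forall i, 0 <= l i) /\ g = \sum_(i < p) l i *: a i.
Proof.
elim: p a g => [|p IH] a g h.
  exists (fun=> 0); split=> //; rewrite big_ord0; apply: dotvv_eq0.
  by apply/eqP; rewrite eq_le dotvv_ge0 h.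
have [hp|/existsNP[x0 /not_implyP[ax0 /negP]]] :=
    pselect (forall x, (forall i, (i < p)%N -> dotv (a i) x <= 0) -> dotv g x <= 0).
  have [l [l0 ->]] := IH a g hp.
  exists (fun i => if i == p then 0 else l i); split=> [i|].
    by case: ifP.
  rewrite big_ord_recr /= eqxx scale0r addr0; apply: eq_bigr => i _.
  by rewrite ltn_eqF.
rewrite -ltNge => gx0.
have px0 : 0 < dotv (a p) x0.
  rewrite ltNge; apply/negP => px0; move: gx0; rewrite ltNge h // => i.
  by rewrite ltnS leq_eqVlt => /orP[/eqP ->|/ax0].
pose s x := x / dotv (a p) x0.
pose a' i := a i - s (dotv (a i) x0) *: a p.
have [|l [l0 gE]] := IH a' (g - s (dotv g x0) *: a p).
  have red b x : dotv (b - s (dotv b x0) *: a p) x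
               = dotv b (x - s (dotv (a p) x) *: x0).
    by rewrite !(dotvDl, dotvDr, dotvNl, dotvNr, dotvZl, dotvZr) /s; ring.
  move=> x hx; rewrite red; apply: h => i.
  rewrite ltnS leq_eqVlt => /orP[/eqP ->|ip]; last by rewrite -red hx.
  by rewrite !(dotvDr, dotvNr, dotvZr) /s mulfVK ?subrr // gt_eqF.
(* Undoing the projection: the last coefficient collects all the shifts. It is nonnegative because
   each [dotv (a i) x0] with i < p is at most 0 while [dotv g x0] and [dotv (a p) x0] are
   positive. *)
exists (fun i => if i == p then s (dotv g x0) - \sum_(i < p) l i * s (dotv (a i) x0)
                 else l i).
split=> [i|].
  case: ifP => // _; rewrite subr_ge0; apply: (@le_trans _ _ 0); last first.
    by rewrite divr_ge0 // ltW.
  apply: sumr_le0 => j _; apply: mulr_ge0_le0 => //.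
  by rewrite mulr_le0_ge0 ?ax0 // invr_ge0 ltW.
rewrite big_ord_recr /= eqxx scalerBl addrCA addrC.
apply: (canRL (subrK _)); rewrite gE scaler_suml -sumrB.
by apply: eq_bigr => i _; rewrite ltn_eqF // scalerBr scalerA.
Qed.

Lemma farkas {R : realType} {p r} (N : 'M[R]_(p, r)) (g : 'cV[R]_r) :
  (forall x, vle (N *m x) 0 -> dotv g x <= 0) ->
  exists2 l : 'cV[R]_p, vle 0 l & g = N^T *m l.
Proof.
move=> h; pose a i := if insub i is Some j then (row j N)^T else 0.
have [|l [l0 gE]] := farkas_seq r p a g.
  move=> x ax; apply: h => i; have := ax i (ltn_ord i).
  by rewrite /a valK mulmx_dotv mxE.
exists (\col_i l i) => [i|]; first by rewrite !mxE.
rewrite gE; apply/colP => i; rewrite summxE mxE; apply: eq_bigr => j _.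
by rewrite /a valK !mxE mulrC.
Qed.

Lemma farkas_eq {R : realType} {p1 p2 r} (N1 : 'M[R]_(p1, r)) (N2 : 'M[R]_(p2, r))
    (g : 'cV[R]_r) :
  (forall x, vle (N1 *m x) 0 -> N2 *m x = 0 -> dotv g x <= 0) ->
  exists (l1 : 'cV[R]_p1) (l2 : 'cV[R]_p2), vle 0 l1 /\ g = N1^T *m l1 + N2^T *m l2.
Proof.
move=> h; have [|l l0 ->] := farkas (col_mx N1 (col_mx N2 (- N2))) g.
  move=> x; rewrite !mul_col_mx => /vle_col_mx0[h1 /vle_col_mx0[h2 h3]].
  apply: h => //.
  apply/colP => i; apply: le_anti.
  have := h2 i; have := h3 i; rewrite mulNmx; move: (N2 *m x) => u.
  by rewrite !mxE oppr_le0 => -> ->.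
move: l0; rewrite -[l]vsubmxK -[dsubmx l]vsubmxK.
move: (usubmx l) (usubmx (dsubmx l)) (dsubmx (dsubmx l)) => a b c.
move=> /vle0_col_mx[a0 _]; exists a, (b - c); split=> //.
rewrite !tr_col_mx !mul_row_col linearN /= mulNmx mulmxBr.
by rewrite !addrA.
Qed.

(** Homogenization: in the system N x <= t d, t >= 0, a solution with t > 0 could be divided by t.
    If the affine system is infeasible, t <= 0 is therefore a consequence, and its multipliers [l],
    [s] satisfy N^T l = 0 and l.d = - 1 - s < 0. *)
Lemma farkas_affine {R : realType} {p r} (N : 'M[R]_(p, r)) (d : 'cV[R]_p) :
  (forall l, vle 0 l -> N^T *m l = 0 -> 0 <= dotv l d) ->
  exists x, vle (N *m x) d.
Proof.
move=> h; apply: contrapT => /forallNP infeasible.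
pose N' := block_mx N (- d) 0 (- 1%:M : 'M[R]_1).
have [|l l0] := farkas N' (col_mx 0 1%:M).
  move=> x; rewrite -[x]vsubmxK; move: (usubmx x) (dsubmx x) => {}x t.
  rewrite /N' mul_block_col => /vle_col_mx0[h1 _].
  rewrite dotv_col_mx dotv0l add0r /dotv trmx1 mul1mx leNgt; apply/negP => t0.
  apply: (infeasible ((t 0 0)^-1 *: x)) => i.
  rewrite -scalemxAr; have := h1 i; rewrite mulNmx; move: (N *m x) => u.
  by rewrite !mxE big_ord1 subr_le0 => du; rewrite mulrC ler_pdivrMr.
move: l0; rewrite -[l]vsubmxK; move: (usubmx l) (dsubmx l) => {}l s.
move=> /vle0_col_mx[l0 s0].
rewrite /N' tr_block_mx mul_block_col => /eq_col_mx[e1 e2].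
have /(h l l0) ld : N^T *m l = 0 by rewrite e1 trmx0 mul0mx addr0.
have := congr1 (fun X : 'cV_1 => X 0 0) e2.
have -> : ((- d)^T *m l + (- 1%:M)^T *m s) 0 0 = - dotv l d - s 0 0.
  rewrite (linearN trmx 1%:M) /= trmx1 mulNmx mul1mx [LHS]mxE [(- s) 0 0]mxE.
  by rewrite dotvC -dotvNl.
by rewrite mxE eqxx mulr1n; have := s0 0; rewrite mxE; clear e1 e2; lra.
Qed.

(** * Minimizers and projections onto polyhedra *)

Lemma l1norm_le_l2norm {R : realType} {n} (u : 'cV[R]_n) :
  l1norm u <= n%:R * l2norm u.
Proof.
rewrite -{2}(card_ord n) mulr_natl -sumr_const; apply: ler_sum => i _.
exact: normr_le_l2norm.
Qed.

(** The sum norm is chosen because linear maps, the norms and the objective have explicit constants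
    for it. Topological continuity is derived from this bound once and for all. *)
Definition l1_lipschitz {R : realType} {n} (f : 'cV[R]_n -> R) : Prop :=
  exists C, forall x z, `|f x - f z| <= C * l1norm (x - z).

Lemma l1_lipschitz_continuous {R : realType} {n} (f : 'cV[R]_n -> R) :
  l1_lipschitz f -> continuous f.
Proof.
move=> [C fC] x; apply/(@cvgrPdist_le _ _ _ (nbhs x) (nbhs_filter x)) => e e0.
have K0 : 0 < `|C| * n%:R + 1 by rewrite ltr_pwDr // mulr_ge0.
near=> z; apply: le_trans (fC x z) _.
have xz : l1norm (x - z) <= n%:R * `|x - z|.
  apply: (@le_trans _ _ (\sum_(i < n) `|x - z|)); last first.
    by rewrite sumr_const card_ord mulr_natl.
  by apply: ler_sum => i _; exact: normr_le_linfnorm.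
have small : `|x - z| <= e / (`|C| * n%:R + 1).
  near: z; apply: (@cvgr_dist_le _ _ _ (nbhs x) _ id x) => //; exact: divr_gt0.
apply: le_trans (ler_wpM2r (l1norm_ge0 _) (ler_norm C)) _.
apply: le_trans (ler_wpM2l (normr_ge0 C) xz) _.
rewrite mulrA; apply: le_trans (ler_wpM2l _ small) _; first by rewrite mulr_ge0.
rewrite mulrCA -[leRHS]mulr1 ler_pM2l // ler_pdivrMr // mul1r.
by rewrite lerDl.
Unshelve. all: by end_near.
Qed.

Lemma l1_lipschitz_dotv {R : realType} {n} (a : 'cV[R]_n) : l1_lipschitz (dotv a).
Proof.
exists (l1norm a) => x z; rewrite -dotvNr -dotvDr.
apply: dotv_le_l1norm => i; exact: normr_le_l1norm.
Qed.

Lemma l1_lipschitz_l1norm {R : realType} {n} : l1_lipschitz (@l1norm R n).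
Proof.
exists 1 => x z; rewrite mul1r ler_norml.
have := l1norm_triangle (x - z) z; have := l1norm_triangle (z - x) x.
by rewrite !subrK -(opprB x z) l1normN => ? ?; apply/andP; split; lra.
Qed.

Lemma l1_lipschitz_l2dist {R : realType} {n} (a : 'cV[R]_n) :
  l1_lipschitz (fun x => l2norm (a - x)).
Proof.
exists 1 => x z; rewrite mul1r.
have h := l2norm_le_l1norm (x - z).
have h1 := l2norm_triangle (a - x) (x - z).
have h2 := l2norm_triangle (a - z) (z - x).
move: h1 h2; rewrite (l2norm_distC z x) !addrA !subrK => ? ?.
by rewrite ler_norml; apply/andP; split; lra.
Qed.

Lemma closed_sublevel {R : realType} {n} (f : 'cV[R]_n -> R) (c : R) :
  l1_lipschitz f -> closed [set x | f x <= c].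
Proof.
move=> /l1_lipschitz_continuous fc.
by apply: (@preimage_closed _ _ f [set t | t <= c]) => //; exact: closed_le.
Qed.

(** Transfers compactness and the extreme value theorem from row vectors to column vectors. *)
Lemma trmx_continuous {R : realType} {m n} : continuous (@trmx R m n).
Proof.
move=> x; apply/(@cvgrPdist_le _ _ _ (nbhs x) (nbhs_filter x)) => e e0.
near=> z.
have h : `|x^T - z^T| <= `|x - z|.
  rewrite -linearB /= {1}/Num.norm /= mx_normrE; apply/bigmax_leP.
  split=> [|[i j] _ /=]; first exact: normr_ge0.
  rewrite mxE {2}/Num.norm /= mx_normrE; apply/bigmax_geP; right.
  by exists (j, i).
apply: le_trans h _.
near: z; exact: (@cvgr_dist_le _ _ _ (nbhs x) _ id x).
Unshelve. all: by end_near.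
Qed.

Lemma attains_min {R : realType} {n} (K : set 'cV[R]_n) (f : 'cV[R]_n -> R) (B : R) :
  K !=set0 -> closed K -> (forall x, K x -> l1norm x <= B) -> l1_lipschitz f ->
  exists2 c, K c & forall x, K x -> f c <= f x.
Proof.
move=> [x0 Kx0] Kcl KB /l1_lipschitz_continuous fcont.
pose K' := [set v : 'rV[R]_n | K v^T].
have K'cl : closed K' by apply: preimage_closed => //; move=> v _; exact: trmx_continuous.
have K'bd : bounded_set K'.
  exists B; split; first exact: num_real.
  move=> M BM v K'v; rewrite /Num.norm /= mx_normrE.
  apply/bigmax_leP; split=> [|[i j] _ /=].
    exact: le_trans (l1norm_ge0 x0) (le_trans (KB _ Kx0) (ltW BM)).
  rewrite (ord1 i); apply: le_trans (ltW BM); apply: le_trans (KB _ K'v).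
  by have := normr_le_l1norm v^T j; rewrite mxE.
have [||c cK' cmin] := @EVT_min_rV _ _ (f \o trmx) _ _ (bounded_closed_compact K'bd K'cl) _.
- by exists x0^T; rewrite /K' /= trmxK.
- apply: continuous_subspaceT => v.
  by apply: continuous_comp; [exact: trmx_continuous|exact: fcont].
exists c^T; first by move: cK'; rewrite inE.
by move=> x Kx; have := cmin x^T; rewrite /= trmxK; apply; rewrite inE /K' /= trmxK.
Qed.

(** [K] may be unbounded, so it is cut down to the points no farther from [x] than a chosen point of
    [K]; the discarded points are farther away than the minimizer. *)
Lemma attains_dist {R : realType} {n} (K : set 'cV[R]_n) (x : 'cV[R]_n) :
  K !=set0 -> closed K ->
  exists2 p, K p & forall z, K z -> l2norm (x - p) <= l2norm (x - z).
Proof.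
move=> [z0 Kz0] Kcl; pose r := l2norm (x - z0).
have [|||p [Kp pr] pmin] := attains_min (K `&` [set z | l2norm (x - z) <= r])
    (fun z => l2norm (x - z)) (l1norm x + n%:R * r) _ _ _ (l1_lipschitz_l2dist x).
- by exists z0; split=> /=.
- by apply: closedI => //; apply: closed_sublevel; exact: l1_lipschitz_l2dist.
- move=> z [_ /= zr].
  have := l1norm_triangle x (z - x); rewrite addrC subrK => /le_trans; apply.
  rewrite lerD2l -opprB l1normN; apply: le_trans (l1norm_le_l2norm _) _.
  by rewrite ler_wpM2l.
exists p => // z Kz; have [zr|/ltW zr] := leP (l2norm (x - z)) r.
  by apply: pmin.
exact: le_trans pr zr.
Qed.

Definition polyhedron {R : realType} {p1 p2 r} (N1 : 'M[R]_(p1, r))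
    (N2 : 'M[R]_(p2, r)) b d : set 'cV[R]_r :=
  [set z | vle (N1 *m z) b /\ N2 *m z = d].

Lemma closed_polyhedron {R : realType} {p1 p2 r} (N1 : 'M[R]_(p1, r))
    (N2 : 'M[R]_(p2, r)) b d : closed (polyhedron N1 N2 b d).
Proof.
have mulmx_lip p (N : 'M[R]_(p, r)) i : l1_lipschitz (fun z => (N *m z) i 0).
  under eq_fun do rewrite mulmx_dotv.
  exact: l1_lipschitz_dotv.
have mulmxN_lip p (N : 'M[R]_(p, r)) i : l1_lipschitz (fun z => - (N *m z) i 0).
  have [C h] := mulmx_lip p N i; exists C => x z.
  by rewrite -opprD normrN.
have -> : polyhedron N1 N2 b d =
    (\bigcap_i [set z | (N1 *m z) i 0 <= b i 0]) `&`
    ((\bigcap_i [set z | (N2 *m z) i 0 <= d i 0]) `&`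
     (\bigcap_i [set z | - (N2 *m z) i 0 <= - d i 0])).
  apply/seteqP; split=> z /=.
    by move=> [h1 <-]; split=> [i _|]; [exact: h1|split=> i _ /=].
  move=> [h1 [h2 h3]]; split=> [i|]; first exact: (h1 i I).
  apply/colP => i; apply: le_anti; rewrite (h2 i I) /=.
  by have := h3 i I; rewrite /= lerN2.
by apply: closedI; [|apply: closedI]; apply: closed_bigI => i _;
  exact: closed_sublevel.
Qed.

(** Here [s] is the slack of a feasible point and [w] the rate at which a direction uses it up: a
    direction that does not increase the active rows can be followed for a while. *)
Lemma small_step {R : realType} {p} (w s : 'cV[R]_p) :
  vle 0 s -> (forall i, s i 0 = 0 -> w i 0 <= 0) ->
  exists2 t0 : R, 0 < t0 & forall t, 0 < t -> t <= t0 -> vle (t *: w) s.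
Proof.
(* Division by 0 gives 0, so rows without slack contribute nothing to [T]. *)
move=> s0 ws; pose T := \sum_i `|w i 0| / s i 0.
have sge i : 0 <= s i 0 by have := s0 i; rewrite mxE.
have T0 : 0 <= T by apply: sumr_ge0 => i _; rewrite divr_ge0.
exists (1 + T)^-1 => [|t tgt0 tle i]; first by rewrite invr_gt0 ltr_pwDl.
rewrite mxE; have [si0|sin0] := eqVneq (s i 0) 0.
  by rewrite si0 mulr_ge0_le0 ?ws // ltW.
have si : 0 < s i 0 by rewrite lt_def sin0 sge.
have wT : `|w i 0| / s i 0 <= T.
  by rewrite /T (bigD1 i) //= lerDl sumr_ge0 // => j _; rewrite divr_ge0.
apply: le_trans (ler_wpM2l (ltW tgt0) (ler_norm _)) _.
rewrite ler_pdivrMr // in wT.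
apply: le_trans (ler_wpM2l (ltW tgt0) wT) _.
rewrite mulrA -[leRHS]mul1r ler_pM2r //.
apply: le_trans (ler_wpM2r T0 tle) _.
by rewrite mulrC ler_pdivrMr ?ltr_pwDl // mul1r lerDr.
Qed.

(** First order conditions at the nearest point [p]: a direction that keeps the equations and does
    not increase the active rows cannot make an acute angle with [x - p], since a small step along
    it would come closer to [x]. Farkas' lemma turns this into multipliers. *)
Lemma polyhedron_projection {R : realType} {p1 p2 r} (N1 : 'M[R]_(p1, r))
    (N2 : 'M[R]_(p2, r)) b d (x : 'cV[R]_r) :
  polyhedron N1 N2 b d !=set0 ->
  exists p l1 l2, [/\ polyhedron N1 N2 b d p, vle 0 l1,
    forall i, (N1 *m p) i 0 != b i 0 -> l1 i 0 = 0 &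
    x - p = N1^T *m l1 + N2^T *m l2].
Proof.
move=> K0; have [p [N1p N2p] pmin] := attains_dist _ x K0 (closed_polyhedron _ _ _ _).
pose act i := (N1 *m p) i 0 == b i 0.
(* Inactive rows are zeroed rather than removed, so that the multipliers keep the index type of
   [N1]. *)
pose N1a := \matrix_(i, j) (if act i then N1 i j else 0).
have N1aE (v : 'cV[R]_r) i : (N1a *m v) i 0 = if act i then (N1 *m v) i 0 else 0.
  rewrite !mxE; case: ifP => ai; last first.
    by rewrite big1 // => j _; rewrite mxE ai mul0r.
  by apply: eq_bigr => j _; rewrite mxE ai.
have [v N1v N2v|l1 [l2 [l1_ge0 gE]]] := farkas_eq N1a N2 (x - p).
  rewrite leNgt; apply/negP => gv.
  have [i|i|t0 t0_gt0 step] := small_step (N1 *m v) (b - N1 *m p).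
  - by have := N1p i; move: (N1 *m p) => a; rewrite !mxE subr_ge0.
  - have -> : (b - N1 *m p) i 0 = b i 0 - (N1 *m p) i 0.
      by rewrite [LHS]mxE; congr (_ + _); rewrite mxE.
    move=> /eqP; rewrite subr_eq0 eq_sym => ai.
    by have := N1v i; rewrite N1aE /act ai [leRHS]mxE.
  (* The squared distance changes by - 2 t g + t^2 |v|^2, which is negative because t (|v|^2 + 1) <=
     g. *)
  pose g := dotv (x - p) v; pose t := Num.min t0 (g / (dotv v v + 1)).
  have v1 : 0 < dotv v v + 1 by rewrite ltr_wpDl // dotvv_ge0.
  have t_gt0 : 0 < t by rewrite lt_min t0_gt0 divr_gt0.
  have /pmin : polyhedron N1 N2 b d (p + t *: v).
    split=> [i|].
      have := step t t_gt0 _ i; rewrite /t ge_min lexx => /(_ isT).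
      rewrite -/t mulmxDr -scalemxAr; move: (N1 *m p) (N1 *m v) => a c.
      by rewrite !mxE; lra.
    by rewrite mulmxDr -scalemxAr N2v scaler0 addr0.
  rewrite leNgt => /negP; apply.
  rewrite -(ltr_pXn2r (n := 2)) ?nnegrE ?l2norm_ge0 // !sqr_l2norm.
  have -> : dotv (x - (p + t *: v)) (x - (p + t *: v)) =
      dotv (x - p) (x - p) - t * g - t * g + t * (t * dotv v v).
    rewrite opprD addrA /g; move: (x - p) => u.
    by rewrite !(dotvDl, dotvDr, dotvNl, dotvNr, dotvZl, dotvZr) (dotvC v u); ring.
  have tg : t * (dotv v v + 1) <= g.
    by rewrite -ler_pdivlMr // /t ge_min lexx orbT.
  have : 0 < t * (g - t * dotv v v + g).
    rewrite mulr_gt0 //; have gg : 0 < g := gv.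
    by have := mulr_gt0 t_gt0 v1; lra.
  by lra.
exists p, (\col_i (if act i then l1 i 0 else 0)), l2; split=> //.
- by move=> i; rewrite !mxE; case: ifP => // _; have := l1_ge0 i; rewrite mxE.
- by move=> i /negPf ai; rewrite mxE /act ai.
- rewrite gE; congr (_ + _); apply/colP => j; rewrite !mxE; apply: eq_bigr => i _.
  by rewrite !mxE; case: ifP => _; rewrite ?mul0r ?mulr0.
Qed.

(** * Robinson's constant as an error bound *)

(* A solution with a maximal set [J] of active rows: if some point of the affine
   space cut out by [J] were infeasible, moving towards it would make a further
   row active. *)
Lemma maximal_active_rows {R : realType} {p1 p2 r} (N1 : 'M[R]_(p1, r))
    (N2 : 'M[R]_(p2, r)) b d :
  polyhedron N1 N2 b d !=set0 ->
  exists u (J : {set 'I_p1}), [/\ polyhedron N1 N2 b d u,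
    forall i, i \in J -> (N1 *m u) i 0 = b i 0 &
    forall v, (forall i, i \in J -> (N1 *m v) i 0 = b i 0) -> N2 *m v = d ->
      polyhedron N1 N2 b d v].
Proof.
move=> K0; pose active (J : {set 'I_p1}) := `[< exists2 u, polyhedron N1 N2 b d u &
  forall i, i \in J -> (N1 *m u) i 0 = b i 0 >].
have active0 : active finset.set0.
  by apply/asboolP; have [u Ku] := K0; exists u => // i; rewrite inE.
have [J /asboolP[u [N1u N2u] uJ] maxJ] : {J : {set 'I_p1} | active J &
    forall J', active J' -> (#|J'| <= #|J|)%N}.
  case: (@arg_maxnP _ finset.set0 active (fun J : {set 'I_p1} => #|J|) active0) => J.
  by exists J.
exists u, J; split=> // v vJ N2v; split=> //; apply: contrapT => /existsNP[i0 i0P].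
pose s i := b i 0 - (N1 *m u) i 0; pose w i := (N1 *m v) i 0 - (N1 *m u) i 0.
have s0 i : 0 <= s i by rewrite subr_ge0.
have bad_i0 : s i0 < w i0 by rewrite ltrD2r ltNge; apply/negP.
have w0 i : i \in J -> w i = 0 by move=> iJ; rewrite /w vJ // uJ // subrr.
(* Ratio test: [i] is a row that becomes active first on the way from [u] to [v]. Rows of [J] have
   [w = 0], so they stay active and [i] is not among them. *)
have [i wi imin] : {i | 0 < w i & forall j, 0 < w j -> s i / w i <= s j / w j}.
  by case: (@arg_minP _ _ _ i0 (fun i => 0 < w i) (fun i => s i / w i)
    (le_lt_trans (s0 i0) bad_i0)) => i wi imin; exists i.
pose t := s i / w i; pose z := u + t *: (v - u).
have t0 : 0 <= t by rewrite divr_ge0 // ltW.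
have zE j : (N1 *m z) j 0 = (N1 *m u) j 0 + t * w j.
  rewrite /z mulmxDr -scalemxAr mulmxBr /w; move: (N1 *m u) (N1 *m v) => a c.
  by rewrite !mxE.
have Kz : polyhedron N1 N2 b d z.
  split=> [j|]; last by rewrite /z mulmxDr -scalemxAr mulmxBr N2v N2u subrr scaler0 addr0.
  rewrite zE -lerBrDl -/(s j); have [wj|wj] := ltP 0 (w j).
    by rewrite -ler_pdivlMr // imin.
  by apply: le_trans (s0 j); exact: mulr_ge0_le0.
have iJ : i \notin J by apply/negP => /w0 wi0; move: wi; rewrite wi0 ltxx.
have := maxJ (i |: J)%SET; rewrite cardsU1 iJ add1n ltnn => /(_ _)/notF; apply.
apply/asboolP; exists z => // j; rewrite !inE => /predU1P[->|jJ].
  by rewrite zE /t divfK ?gt_eqF // /s addrC subrK.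
by rewrite zE w0 // mulr0 addr0 uJ.
Qed.

(** Makes the supremum in [robinson_mu] one of a bounded set. By [maximal_active_rows] any solution
    of the equations for the rows in [J] together with [N2 *m v = d] is feasible, and a
    pseudoinverse provides one that is linear in the data. Summing over all [J] makes the constant
    independent of the data. *)
Lemma polyhedron_small_point {R : realType} {p1 p2 r} (N1 : 'M[R]_(p1, r))
    (N2 : 'M[R]_(p2, r)) :
  exists2 C, 0 <= C & forall b d, polyhedron N1 N2 b d !=set0 ->
    exists2 u, polyhedron N1 N2 b d u & linfnorm u <= C * l2norm (col_mx b d).
Proof.
pose N1J (J : {set 'I_p1}) := \matrix_(i, j) (if i \in J then N1 i j else 0).
(* [pinvmx] solves systems with the unknown on the left, hence the transposes. *)
pose Q J := pinvmx (col_mx (N1J J) N2)^T.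
pose c J := \sum_i \sum_j `|Q J j i|.
have c0 J : 0 <= c J by apply: sumr_ge0 => i _; apply: sumr_ge0.
exists (\sum_J c J) => [|b d /maximal_active_rows[u [J [[N1u N2u] uJ vJ]]]].
  exact: sumr_ge0.
pose bJ := \col_i (if i \in J then b i 0 else 0).
have N1JE (v : 'cV[R]_r) i : (N1J J *m v) i 0 = if i \in J then (N1 *m v) i 0 else 0.
  rewrite !mxE; case: ifP => ai; last first.
    by rewrite big1 // => j _; rewrite mxE ai mul0r.
  by apply: eq_bigr => j _; rewrite mxE ai.
have uE : col_mx (N1J J) N2 *m u = col_mx bJ d.
  rewrite mul_col_mx N2u; congr col_mx; apply/colP => i; rewrite N1JE [RHS]mxE.
  by case: ifP => // /uJ.
pose v := (Q J)^T *m col_mx bJ d.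
have vE : col_mx (N1J J) N2 *m v = col_mx bJ d.
  apply: trmx_inj; rewrite /v !trmx_mul !trmxK mulmxKpV //.
  by rewrite -uE trmx_mul submxMl.
have [vE1 vE2] : N1J J *m v = bJ /\ N2 *m v = d.
  by move: vE; rewrite mul_col_mx => /eq_col_mx.
exists v.
  by apply: vJ => // i iJ; have := N1JE v i; rewrite vE1 mxE iJ.
have bJ_le k : `|(col_mx bJ d) k 0| <= l2norm (col_mx b d).
  apply: le_trans (normr_le_l2norm _ k).
  case: (split_ordP k) => i ->; rewrite ?col_mxEd // !col_mxEu mxE.
  by case: ifP => // _; rewrite normr0.
apply: (@le_trans _ _ (c J * l2norm (col_mx b d))); last first.
  by rewrite ler_wpM2r ?l2norm_ge0 // (bigD1 J) //= lerDl sumr_ge0.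
apply: linfnorm_le => [|i]; first by rewrite mulr_ge0 ?l2norm_ge0.
rewrite /v mulmx_dotv; apply: (@le_trans _ _ ((\sum_j `|Q J j i|) * l2norm (col_mx b d))).
  rewrite dotvE mulr_suml; apply: le_trans (ler_norm_sum _ _ _) _.
  by apply: ler_sum => j _; rewrite 3!mxE normrM ler_wpM2l.
rewrite ler_wpM2r ?l2norm_ge0 // /c (bigD1 i) //= lerDl sumr_ge0 // => j _.
exact: sumr_ge0.
Qed.

Lemma inf_solutions_le {R : realType} {p1 p2 r} (N1 : 'M[R]_(p1, r))
    (N2 : 'M[R]_(p2, r)) b d u : solutions N1 N2 b d u ->
  inf [set linfnorm u | u in solutions N1 N2 b d] <= linfnorm u.
Proof.
move=> Ku; apply: ge_inf; last by exists u.
by exists 0 => _ [z _ <-]; exact: linfnorm_ge0.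
Qed.

Lemma inf_solutions_le_robinson_mu {R : realType} {p1 p2 r} (N1 : 'M[R]_(p1, r))
    (N2 : 'M[R]_(p2, r)) b d :
  solutions N1 N2 b d !=set0 -> l2norm (col_mx b d) <= 1 ->
  inf [set linfnorm u | u in solutions N1 N2 b d] <=
    robinson_mu (@linfnorm R) (@l2norm R) N1 N2.
Proof.
move=> Kbd bd1; have [C C0 small] := polyhedron_small_point N1 N2.
apply: ub_le_sup; last by exists b, d.
exists C => _ [b' [d' [Kb'd' bd'1 ->]]]; have [u Ku Cu] := small b' d' Kb'd'.
apply: le_trans (inf_solutions_le _ _ _ _ _ Ku) _; apply: le_trans Cu _.
by rewrite -[leRHS]mulr1 ler_wpM2l.
Qed.

Lemma robinson_mu_ge0 {R : realType} {p1 p2 r} (N1 : 'M[R]_(p1, r))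
    (N2 : 'M[R]_(p2, r)) :
  0 <= robinson_mu (@linfnorm R) (@l2norm R) N1 N2.
Proof.
have sol0 : solutions N1 N2 0 0 0.
  by split=> [i|]; rewrite mulmx0 // mxE.
apply: (@le_trans _ _ (inf [set linfnorm u | u in solutions N1 N2 0 0])); last first.
  by apply: inf_solutions_le_robinson_mu; [exists 0|rewrite col_mx0 l2norm0 ler01].
apply: lb_le_inf; first by exists (linfnorm (0 : 'cV[R]_r)), 0.
by move=> _ [u _ <-]; exact: linfnorm_ge0.
Qed.

(** Homogeneity: dividing the data by their norm divides the solutions by the same factor. Data of
    norm 0 cannot be normalized; there the linear bound of [polyhedron_small_point] yields a
    solution of norm 0. *)
Lemma inf_solutions_le_robinson {R : realType} {p1 p2 r} (N1 : 'M[R]_(p1, r))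
    (N2 : 'M[R]_(p2, r)) b d :
  solutions N1 N2 b d !=set0 ->
  inf [set linfnorm u | u in solutions N1 N2 b d] <=
    robinson_mu (@linfnorm R) (@l2norm R) N1 N2 * l2norm (col_mx b d).
Proof.
move=> Kbd; have [L0|L_neq0] := eqVneq (l2norm (col_mx b d)) 0.
  have [C C0 small] := polyhedron_small_point N1 N2.
  have [u Ku] := small b d Kbd; rewrite L0 !mulr0; apply: le_trans.
  exact: inf_solutions_le.
pose L := l2norm (col_mx b d).
have L_gt0 : 0 < L by rewrite lt_def L_neq0 l2norm_ge0.
have scaled (a : R) u b' d' : 0 <= a -> solutions N1 N2 b' d' u ->
    solutions N1 N2 (a *: b') (a *: d') (a *: u).
  move=> a0 [h1 h2]; split=> [i|]; last by rewrite -scalemxAr h2.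
  rewrite -scalemxAr; have := h1 i; move: (N1 *m u) => w.
  by rewrite !mxE; exact: ler_wpM2l.
have L'0 : 0 <= L^-1 by rewrite invr_ge0 ltW.
have [u0 Ku0] := Kbd.
rewrite -ler_pdivrMr //.
apply: (@le_trans _ _ (inf [set linfnorm u | u in solutions N1 N2 (L^-1 *: b) (L^-1 *: d)])).
  apply: lb_le_inf.
    by exists (linfnorm (L^-1 *: u0)), (L^-1 *: u0) => //; exact: scaled.
  move=> _ [u Ku <-]; rewrite ler_pdivrMr //.
  have := scaled L _ _ _ (ltW L_gt0) Ku; rewrite !scalerA divff // !scale1r.
  move=> /inf_solutions_le /le_trans; apply; apply: linfnorm_le => [|i].
    by rewrite mulr_ge0 ?linfnorm_ge0 // ltW.
  by rewrite mxE normrM gtr0_norm // mulrC ler_pM2r // normr_le_linfnorm.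
apply: inf_solutions_le_robinson_mu; first by exists (L^-1 *: u0); exact: scaled.
by rewrite -scale_col_mx l2normZ ger0_norm // mulVf.
Qed.

Lemma robinson_sigma_ge {R : realType} {m1 m2 l} (N1 : 'M[R]_(m1, l))
    (N2 : 'M[R]_(m2, l)) (S : {set 'I_m1}) :
  robinson_mu (@linfnorm R) (@l2norm R)
    (block_mx (rows_id S) 0 (- 1%:M) (0 : 'M[R]_(m1, m2))) (col_mx N1 N2)^T <=
  robinson_sigma (@linfnorm R) (@l2norm R) N1 N2.
Proof.
apply: ub_le_sup; last by exists S.
pose f (T : {set 'I_m1}) := robinson_mu (@linfnorm R) (@l2norm R)
    (block_mx (rows_id T) 0 (- 1%:M) (0 : 'M[R]_(m1, m2))) (col_mx N1 N2)^T.
exists (\sum_T `|f T|) => _ [T _ <-]; apply: le_trans (ler_norm _) _.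
by rewrite (bigD1 T) //= lerDl sumr_ge0.
Qed.

Lemma robinson_sigma_ge0 {R : realType} {m1 m2 l} (N1 : 'M[R]_(m1, l))
    (N2 : 'M[R]_(m2, l)) :
  0 <= robinson_sigma (@linfnorm R) (@l2norm R) N1 N2.
Proof.
exact: le_trans (robinson_mu_ge0 _ _) (robinson_sigma_ge N1 N2 finset.set0).
Qed.

(* Hoffman's bound with Robinson's constant: [x - p] is normal to the polyhedron
   at the projection [p] of [x], and pairing it with itself through any
   multipliers bounds its square by their size times the residual. *)
Lemma robinson_error_bound {R : realType} {m1 m2 l} (N1 : 'M[R]_(m1, l))
    (N2 : 'M[R]_(m2, l)) b d (x : 'cV[R]_l) :
  polyhedron N1 N2 b d !=set0 ->
  exists2 p, polyhedron N1 N2 b d p &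
    l2norm (x - p) <= robinson_sigma (@linfnorm R) (@l2norm R) N1 N2 *
      (\sum_i Num.max 0 ((N1 *m x - b) i 0) + l1norm (N2 *m x - d)).
Proof.
move=> /(fun h => polyhedron_projection _ _ _ _ x h).
move=> [p [l1 [l2 [[N1p N2p] l1_ge0 l1act xpE]]]]; exists p => //.
set sigma := robinson_sigma _ _ _ _.
set res := \sum_i _ + l1norm _.
pose D := l2norm (x - p).
have D0 : 0 <= D by exact: l2norm_ge0.
(* The subset in Robinson's constant is taken to be the inactive rows: [B1 *m u <= 0] says that the
   first part of [u] is nonnegative and vanishes on [S]. So [sol] consists of all multipliers
   representing [x - p], and its data have norm [D]. *)
pose S := [set i | (N1 *m p) i 0 != b i 0]%SET.
pose B1 := block_mx (rows_id S) 0 (- 1%:M) (0 : 'M[R]_(m1, m2)).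
pose sol := solutions B1 (col_mx N1 N2)^T 0 (x - p).
have B1E (u1 : 'cV[R]_m1) (u2 : 'cV[R]_m2) :
    B1 *m col_mx u1 u2 = col_mx (rows_id S *m u1) (- u1).
  by rewrite /B1 mul_block_col !mul0mx !addr0 mulNmx mul1mx.
have rowsE (u1 : 'cV[R]_m1) j : (rows_id S *m u1) j 0 = u1 (enum_val j) 0.
  rewrite mxE (bigD1 (enum_val j)) //= !mxE eqxx mul1r big1 ?addr0 // => i.
  by rewrite eq_sym => /negPf ij; rewrite !mxE ij mul0r.
have sol_l : sol (col_mx l1 l2).
  split; last by rewrite tr_col_mx mul_row_col -xpE.
  rewrite B1E; apply/vle_col_mx0; split=> j.
    by rewrite rowsE l1act ?[leRHS]mxE //; have := enum_valP j; rewrite inE.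
  by have := l1_ge0 j; rewrite !mxE oppr_le0.
(* On an active row [(N1 *m (x - p)) i 0] is the residual at [x], and the other rows carry
   multiplier 0. *)
have sq_le u : sol u -> D ^+ 2 <= linfnorm u * res.
  rewrite -[u]vsubmxK; move: (usubmx u) (dsubmx u) => u1 u2 [].
  rewrite B1E => /vle_col_mx0[hS hN]; rewrite tr_col_mx mul_row_col => uE.
  rewrite sqr_l2norm -{1}uE dotvDl -!dotv_mulmx mulrDr.
  have c_ge0 := linfnorm_ge0 (col_mx u1 u2).
  have le_c := normr_le_linfnorm (col_mx u1 u2).
  apply: lerD; last first.
    rewrite mulmxBr N2p; apply: le_trans (ler_norm _) _.
    by apply: dotv_le_l1norm => i; have := le_c (rshift m1 i); rewrite col_mxEd.
  rewrite dotvE mulr_sumr; apply: ler_sum => i _.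
  have m0 : 0 <= Num.max 0 ((N1 *m x - b) i 0) by rewrite le_max lexx.
  have u1_ge0 : 0 <= u1 i 0 by have := hN i; rewrite !mxE oppr_le0.
  have u1_le : u1 i 0 <= linfnorm (col_mx u1 u2).
    by have := le_c (lshift m2 i); rewrite col_mxEu; apply: le_trans (ler_norm _).
  have [iS|] := boolP (i \in S).
    have := hS (enum_rank_in iS i); rewrite rowsE enum_rankK_in // [leRHS]mxE => u1_le0.
    have -> : u1 i 0 = 0 by apply: le_anti; rewrite u1_le0.
    by rewrite mul0r mulr_ge0.
  rewrite inE negbK => /eqP actb.
  have -> : (N1 *m (x - p)) i 0 = (N1 *m x - b) i 0.
    rewrite mulmxBr; move: actb; move: (N1 *m p) (N1 *m x) => a1 a2.
    by rewrite !mxE => ->.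
  apply: le_trans (ler_wpM2r m0 u1_le).
  by rewrite ler_wpM2l // le_max lexx orbT.
have res0 : 0 <= res.
  rewrite addr_ge0 ?l1norm_ge0 // sumr_ge0 // => i _.
  by rewrite le_max lexx.
have infle : inf [set linfnorm u | u in sol] <= sigma * D.
  have /inf_solutions_le_robinson : sol !=set0 by exists (col_mx l1 l2).
  move=> /le_trans; apply.
  rewrite l2norm_col_mx0.
  by rewrite ler_wpM2r // robinson_sigma_ge.
have [D_eq0|D_neq0] := eqVneq D 0.
  by rewrite -/D D_eq0 mulr_ge0 // robinson_sigma_ge0.
have D_gt0 : 0 < D by rewrite lt_def D_neq0.
have res_gt0 : 0 < res.
  rewrite lt_def res0 andbT; apply/negP => /eqP r0.
  by have := sq_le _ sol_l; rewrite r0 mulr0 leNgt exprn_gt0.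
rewrite -(ler_pM2r D_gt0) -expr2 mulrAC -ler_pdivrMr //.
apply: le_trans infle; apply: lb_le_inf.
  by exists (linfnorm (col_mx l1 l2)), (col_mx l1 l2).
by move=> _ [u Ku <-]; rewrite ler_pdivrMr // sq_le.
Qed.

(** * Null space and range space properties *)

Lemma l1norm_on_ge0 {R : realType} {n} (S : {set 'I_n}) (x : 'cV[R]_n) :
  0 <= l1norm_on S x.
Proof. exact: sumr_ge0. Qed.

Lemma l1norm_on0 {R : realType} {n} (S : {set 'I_n}) :
  l1norm_on S (0 : 'cV[R]_n) = 0.
Proof. by rewrite /l1norm_on big1 // => i _; rewrite mxE normr0. Qed.

Lemma l1norm_split {R : realType} {n} (S : {set 'I_n}) (x : 'cV[R]_n) :
  l1norm x = l1norm_on S x + l1norm_on (~: S)%SET x.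
Proof.
rewrite /l1norm (bigID (mem S)) /=; congr (_ + _).
by apply: eq_bigl => i; rewrite inE.
Qed.

Lemma l1norm_on_sub {R : realType} {n} (S T : {set 'I_n}) (x : 'cV[R]_n) :
  S \subset T -> l1norm_on S x <= l1norm_on T x.
Proof.
move=> /fintype.subsetP ST; rewrite /l1norm_on [leRHS](bigID (mem S)) /=.
rewrite -[leLHS]addr0 lerD ?sumr_ge0 // le_eqVlt; apply/orP; left; apply/eqP.
apply: eq_bigl => i; have [iS|_] := boolP (i \in S); last by rewrite andbF.
by rewrite ST.
Qed.

(** [T] maximizes the sum of the |g_i| and [tau] is the largest |g_i| left out of it; exchanging two
    indices shows that [tau] separates. The last equation covers the case |T| < k: inserting an
    index then shows that everything left out is 0, so [tau = 0]. *)
Lemma top_coordinates {R : realType} {n} (k : nat) (U : {set 'I_n}) (g : 'cV[R]_n) :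
  exists (T : {set 'I_n}) (tau : R),
    [/\ T \subset U, (#|T| <= k)%N,
        forall T' : {set 'I_n}, T' \subset U -> (#|T'| <= k)%N ->
          l1norm_on T' g <= l1norm_on T g
      & [/\ 0 <= tau, forall i, i \in T -> tau <= `|g i 0|,
        forall i, i \in U -> i \notin T -> `|g i 0| <= tau
      & tau * k%:R = tau * #|T|%:R]].
Proof.
pose P (T : {set 'I_n}) := (T \subset U) && (#|T| <= k)%N.
have P0 : P finset.set0 by rewrite /P finset.sub0set cards0.
have [T /andP[TU Tk] Tmax] : {T | P T & forall T', P T' -> l1norm_on T' g <= l1norm_on T g}.
  by case: (@arg_maxP _ _ _ _ P (fun T => l1norm_on T g) P0) => T PT Tmax; exists T.
pose tau := \big[Num.max/0]_(j in (U :\: T)%SET) `|g j 0|.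
have tau0 : 0 <= tau by apply: bigmax_ge_id.
have le_tau i : i \in U -> i \notin T -> `|g i 0| <= tau.
  by move=> iU iT; apply: (le_bigmax_cond _ (fun j => `|g j 0|)); rewrite inE iU iT.
have insert i : i \in U -> i \notin T -> (#|T| < k)%N -> `|g i 0| <= 0.
  move=> iU iT Tlt; have := Tmax (i |: T)%SET.
  rewrite /P cardsU1 iT add1n Tlt finset.subUset finset.sub1set iU TU => /(_ isT).
  by rewrite /l1norm_on big_setU1 //= gerDr.
exists T, tau; split=> // [T' T'U T'k|]; first by apply: Tmax; rewrite /P T'U.
split=> // [i iT|].
  apply/bigmax_leP; split=> // j; rewrite inE => /andP[jT jU].
  have := Tmax (j |: (T :\ i))%SET.
  have jTi : j \notin (T :\ i)%SET by rewrite !inE negb_and jT orbT.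
  have cT : #|T| = (#|(T :\ i)%SET|).+1 by rewrite (cardsD1 i) iT.
  have sT : (T :\ i)%SET \subset U by apply: fintype.subset_trans TU; exact: subD1set.
  rewrite /P cardsU1 jTi add1n -cT Tk finset.subUset finset.sub1set jU sT => /(_ isT).
  rewrite /l1norm_on big_setU1 //= => h.
  by rewrite -(lerD2r (\sum_(i0 in (T :\ i)%SET) `|g i0 0|)) -big_setD1.
have [Tlt|kT] := ltnP #|T| k; last first.
  by have -> : #|T| = k by apply/eqP; rewrite eqn_leq Tk kT.
have -> : tau = 0.
  apply: le_anti; rewrite tau0 andbT; apply/bigmax_leP; split=> // j.
  by rewrite inE => /andP[jT jU]; exact: insert.
by rewrite !mul0r.
Qed.

(** On the polytope |v_i| <= alpha, |v|_1 <= k alpha, a linear functional is largest at a point with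
    at most k entries, each alpha or -alpha. The threshold [tau] is the multiplier of the constraint
    on |v|_1. This takes the place of writing [v] as a convex combination of k-sparse vectors. *)
Lemma sum_top_coordinates {R : realType} {n} (k : nat) (U : {set 'I_n})
    (g : 'cV[R]_n) : exists T : {set 'I_n}, [/\ T \subset U, (#|T| <= k)%N &
  forall (alpha : R) (v : 'cV[R]_n), (forall i, i \in U -> `|v i 0| <= alpha) ->
    l1norm_on U v <= k%:R * alpha ->
    \sum_(i in U) `|g i 0| * `|v i 0| <= alpha * l1norm_on T g].
Proof.
have [T [tau [TU Tk _ [tau0 tauT tauU tauk]]]] := top_coordinates k U g.
exists T; split=> // alpha v valpha v1.
have splitU (F : 'I_n -> R) :
    \sum_(i in U) F i = \sum_(i in T) F i + \sum_(i in (U :\: T)%SET) F i.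
  rewrite (bigID (mem T)) /=; congr (_ + _); apply: eq_bigl => i.
    by have [iT|_] := boolP (i \in T); rewrite ?andbF ?andbT // (fintype.subsetP TU).
  by rewrite inE andbC.
have h1 : \sum_(i in (U :\: T)%SET) `|g i 0| * `|v i 0| <=
    tau * \sum_(i in (U :\: T)%SET) `|v i 0|.
  rewrite mulr_sumr; apply: ler_sum => i; rewrite inE => /andP[iT iU].
  by rewrite ler_wpM2r // tauU.
move: v1; rewrite /l1norm_on !splitU => v1.
have h2 := ler_wpM2l tau0 v1.
have h3 : \sum_(i in T) `|g i 0| * `|v i 0| + \sum_(i in T) tau * (alpha - `|v i 0|)
    <= alpha * \sum_(i in T) `|g i 0|.
  rewrite -big_split mulr_sumr /=; apply: ler_sum => i iT.
  have := tauT i iT; have := valpha i (fintype.subsetP TU i iT) => va ta.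
  have : tau * (alpha - `|v i 0|) <= `|g i 0| * (alpha - `|v i 0|).
    by rewrite ler_wpM2r // subr_ge0.
  by lra.
move: h3; rewrite -mulr_sumr sumrB sumr_const -mulr_natr => h3.
have h4 : tau * (k%:R * alpha) = tau * (alpha * #|T|%:R) by rewrite mulrA tauk; ring.
move: h2; rewrite h4 mulrDr => h2; move: h3; rewrite mulrBr => h3.
by lra.
Qed.

Definition weak_NSP {R : realType} {m n} (A : 'M[R]_(m, n)) (k : nat) : Prop :=
  forall z : 'cV[R]_n, A *m z = 0 -> forall S : {set 'I_n}, (#|S| <= k)%N ->
    l1norm_on S z <= l1norm_on (~: S)%SET z.

Lemma weak_NSP_of_NSP {R : realType} {m n} (A : 'M[R]_(m, n)) k :
  NSP A k -> weak_NSP A k.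
Proof.
move=> h z Az S Sk; have [->|z0] := eqVneq z 0; first by rewrite !l1norm_on0.
exact/ltW/h.
Qed.

Lemma weak_NSP_of_stable {R : realType} {m n} (A : 'M[R]_(m, n)) k rho :
  stable_NSP A k rho -> weak_NSP A k.
Proof.
move=> [rho0 rho1 h] z Az S Sk; have [->|z0] := eqVneq z 0.
  by rewrite !l1norm_on0.
apply: le_trans (h z z0 Az S Sk) _.
by rewrite ler_piMl ?l1norm_on_ge0 // ltW.
Qed.

Lemma weak_NSP_of_robust {R : realType} {m n} (A : 'M[R]_(m, n)) k nrm rho1 rho2 :
  robust_NSP A k nrm rho1 rho2 -> weak_NSP A k.
Proof.
move=> [[_ _ nrmZ _] rho0 rho_lt1 _ h] z Az S Sk.
apply: le_trans (h z S Sk) _; rewrite Az.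
have -> : nrm 0 = 0 by rewrite -(scale0r 0) nrmZ normr0 mul0r.
by rewrite mulr0 addr0 ler_piMl ?l1norm_on_ge0 // ltW.
Qed.

Lemma mu1_ge {R : realType} {m n} (A : 'M[R]_(m, n)) k i (S : {set 'I_n}) :
  #|S| = k -> i \notin S ->
  \sum_(j in S) `|dotv (col i A) (col j A)| <= mu1 A k.
Proof.
move=> Sk iS; apply: ub_le_sup; last by exists i, S.
exists (\sum_i \sum_j `|dotv (col i A) (col j A)|) => _ [i' [S' [_ _ ->]]].
apply: (@le_trans _ _ (\sum_j `|dotv (col i' A) (col j A)|)).
  by rewrite [leRHS](bigID (mem S')) /= lerDl sumr_ge0.
by rewrite [leRHS](bigD1 i') //= lerDl sumr_ge0 // => j _; exact: sumr_ge0.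
Qed.

Lemma superset_of_card {n} k (S : {set 'I_n}) : (#|S| <= k <= n)%N ->
  exists2 T : {set 'I_n}, S \subset T & #|T| = k.
Proof.
elim: k => [|k IH] /andP[Sk kn].
  by exists S => //; apply/eqP; rewrite -leqn0.
move: Sk; rewrite leq_eqVlt => /orP[/eqP Sk|Sk]; first by exists S.
have [|T ST Tk] := IH; first by rewrite -ltnS Sk ltnW.
have /set0Pn[i] : (~: T)%SET != finset.set0.
  by rewrite -card_gt0 cardsCs finset.setCK card_ord Tk subn_gt0.
rewrite inE => iT; exists (i |: T)%SET; last by rewrite cardsU1 iT Tk.
by apply: fintype.subset_trans ST _; exact: subsetU1.
Qed.

(** Pairing A z = 0 with column i gives |z_i| <= sum over j != i of |a_i.a_j| |z_j|. Summed over i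
    in S, an index j of S collects at most mu_1(k-1) and an index outside S at most mu_1(k). *)
Lemma weak_NSP_of_coherence {R : realType} {m n} (A : 'M[R]_(m, n)) k :
  (1 <= k <= n - 1)%N -> normalized_columns A -> mu1 A k + mu1 A (k - 1) < 1 ->
  weak_NSP A k.
Proof.
move=> /andP[k1 kn] An mu_lt1 z Az S0 S0k.
have kn' : (k <= n)%N by apply: leq_trans kn _; rewrite leq_subr.
(* [mu1] ranges over sets of exactly k indices; enlarging [S0] only strengthens the claim. *)
have [|S S0S Sk] := superset_of_card k S0; first by rewrite S0k.
apply: le_trans (l1norm_on_sub _ _ z S0S) _.
apply: (@le_trans _ _ (l1norm_on (~: S)%SET z)); last first.
  by apply: l1norm_on_sub; rewrite finset.setCS.
pose G i j := `|dotv (col i A) (col j A)|.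
have Gsym i j : G i j = G j i by rewrite /G dotvC.
have zi i : `|z i 0| <= \sum_(j | j != i) G i j * `|z j 0|.
  have : dotv (col i A) (A *m z) = 0 by rewrite Az dotv0r.
  rewrite dotv_mulmx dotvE (bigD1 i) //=.
  have GE j : (A^T *m col i A) j 0 = dotv (col i A) (col j A).
    by rewrite mulmx_dotv dotvC -tr_col trmxK.
  rewrite GE -sqr_l2norm An expr1n mul1r => /eqP; rewrite addr_eq0 => /eqP ->.
  rewrite normrN; apply: le_trans (ler_norm_sum _ _ _) _.
  by apply: ler_sum => j _; rewrite normrM GE.
have inS j : j \in S -> \sum_(i in S | i != j) G j i <= mu1 A (k - 1).
  move=> jS; have := mu1_ge A (k - 1) j (S :\ j)%SET.
  have -> : #|(S :\ j)%SET| = (k - 1)%N by rewrite -Sk (cardsD1 j S) jS add1n subn1.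
  rewrite !inE eqxx => /(_ erefl isT); apply: le_trans.
  by rewrite le_eqVlt; apply/orP; left; apply/eqP; apply: eq_bigl => i; rewrite !inE andbC.
have outS j : j \notin S -> \sum_(i in S) G j i <= mu1 A k.
  by move=> jS; exact: mu1_ge.
have main : l1norm_on S z <=
    mu1 A (k - 1) * l1norm_on S z + mu1 A k * l1norm_on (~: S)%SET z.
  apply: (@le_trans _ _ (\sum_(i in S) \sum_(j | j != i) G i j * `|z j 0|)).
    exact: ler_sum.
  rewrite (exchange_big_dep predT) //= (bigID (mem S)) /=; apply: lerD.
    rewrite /l1norm_on mulr_sumr; apply: ler_sum => j jS.
    rewrite -mulr_suml ler_wpM2r //; apply: le_trans (inS j jS).
    rewrite le_eqVlt; apply/orP; left; apply/eqP; apply: eq_big => i.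
      by rewrite eq_sym.
    by move=> _; rewrite Gsym.
  rewrite /l1norm_on mulr_sumr [leRHS](eq_bigl (fun j => j \notin S)); last first.
    by move=> j; rewrite inE.
  apply: ler_sum => j jS; rewrite -mulr_suml ler_wpM2r //.
  apply: le_trans (outS j jS); rewrite le_eqVlt; apply/orP; left; apply/eqP.
  apply: eq_big => i; last by rewrite Gsym.
  by have [<-|] := eqVneq j i; rewrite ?andbT // (negPf jS).
(* Since k <= n - 1 there is an index outside [S], so the set whose supremum is [mu1 A k] has an
   element, a sum of absolute values. *)
have muk : 0 <= mu1 A k.
  have /set0Pn[i] : (~: S)%SET != finset.set0.
    rewrite -card_gt0 cardsCs finset.setCK card_ord Sk subn_gt0.
    by apply: leq_ltn_trans kn _; rewrite subn1 prednK // (leq_trans k1).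
  rewrite inE => iS; apply: le_trans (mu1_ge A k i S Sk iS).
  exact: sumr_ge0.
have a0 := l1norm_on_ge0 S z; have b0 := l1norm_on_ge0 (~: S)%SET z.
move: main mu_lt1 muk a0 b0; clear.
move: (mu1 A k) (mu1 A (k - 1)) (l1norm_on S z) (l1norm_on (~: S)%SET z).
move=> p q a b main pq p0 a0 b0; rewrite leNgt; apply/negP => ba.
have := ler_wpM2l p0 (ltW ba).
have := mulr_gt0 (le_lt_trans b0 ba) (_ : 0 < 1 - p - q).
by move=> /(_ ltac:(lra)); lra.
Qed.

(* [(t^2 - t) <Ax, A(x + u)>] is the combination of [|A((1/2 - t)x - (t/2)u)|^2]
   and [|A(x + tu)|^2] in which the terms in [|Au|^2] cancel; [t = sqrt 2 - 1]
   makes the resulting bound negative exactly when [d < 1 / sqrt 2]. *)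
Lemma RIP_inner_le0 {R : realType} {m n} (A : 'M[R]_(m, n)) k d
    (S T : {set 'I_n}) (x u : 'cV[R]_n) :
  RIP A (2 * k) d -> d < 1 / Num.sqrt 2 -> (#|S| <= k)%N -> (#|T| <= k)%N ->
  (forall i, i \in S -> i \notin T) ->
  (forall i, i \notin S -> x i 0 = 0) -> (forall i, i \notin T -> u i 0 = 0) ->
  dotv u u <= dotv x x -> dotv (A *m x) (A *m (x + u)) <= 0 -> x = 0.
Proof.
move=> [d0 d1 rip] d_lt Sk Tk dST xS uT UX; rewrite mulmxDr dotvDr => ab.
pose t : R := Num.sqrt 2 - 1.
have s2 : Num.sqrt 2 ^+ 2 = 2 :> R by rewrite sqr_sqrtr.
have s_gt0 : 0 < Num.sqrt 2 :> R by rewrite sqrtr_gt0.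
have t2 : t * t = 1 - 2 * t by rewrite /t; lra.
have s_gt : 7 / 5 < Num.sqrt 2 :> R.
  by rewrite -(ltr_pXn2r (n := 2)) ?nnegrE ?ltW // s2; lra.
have s_lt : Num.sqrt 2 < 3 / 2 :> R.
  by rewrite -(ltr_pXn2r (n := 2)) ?nnegrE ?ltW // s2; lra.
have dt : d * (1 + t) < 1 by rewrite /t addrC subrK -ltr_pdivlMr.
have sparse (a b : R) : (l0norm (a *: x + b *: u) <= 2 * k)%N.
  rewrite mul2n -addnn; apply: leq_trans (leq_add Sk Tk).
  apply: leq_trans (leq_card_setU S T); apply: subset_leq_card.
  apply/fintype.subsetP => i; rewrite !inE !mxE; apply: contraNT.
  by rewrite negb_or => /andP[/xS -> /uT ->]; rewrite !mulr0 addr0.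
have xu : dotv x u = 0.
  rewrite dotvE big1 // => i _; have [iS|/xS ->] := boolP (i \in S); last exact: mul0r.
  by rewrite uT ?mulr0 // dST.
have sq (B : 'M[R]_(m, n)) (a b : R) :
    dotv (B *m (a *: x + b *: u)) (B *m (a *: x + b *: u)) =
    a * a * dotv (B *m x) (B *m x) + 2 * a * b * dotv (B *m x) (B *m u) +
    b * b * dotv (B *m u) (B *m u).
  rewrite mulmxDr -!scalemxAr; move: (B *m x) (B *m u) => w1 w2.
  by rewrite !(dotvDl, dotvDr, dotvZl, dotvZr) (dotvC w2 w1); ring.
have sq1 (a b : R) : dotv (a *: x + b *: u) (a *: x + b *: u) =
    a * a * dotv x x + b * b * dotv u u.
  by rewrite !(dotvDl, dotvDr, dotvZl, dotvZr) (dotvC u x) xu; ring.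
(* The upper isometry bound is used for this vector and the lower one for x + t u; the first square
   minus a quarter of the second is the required combination. *)
have /andP[_] := rip _ (sparse (1 / 2 - t) (- (t / 2))).
have /andP[+ _] := rip _ (sparse 1 t).
rewrite !sqr_l2norm !sq !sq1.
have X0 := dotvv_ge0 x; have U0 := dotvv_ge0 u.
move: ab UX X0 U0 (@dotvv_eq0 R n x).
move: (dotv (A *m x) (A *m x)) (dotv (A *m x) (A *m u)) (dotv (A *m u) (A *m u)) => a b c.
move: (dotv x x) (dotv u u) => X U ab UX X0 U0 xeq0 r1 r2.
apply: xeq0; apply/eqP; rewrite eq_le X0 andbT leNgt; apply/negP => X_gt0.
have tt : 2 / 5 < t by rewrite /t; lra.
have tlt : t < 1 / 2 by rewrite /t; lra.
have e1 : 0 <= (t * t - t) * (a + b).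
  by apply: mulr_le0 => //; rewrite t2; lra.
have e2 : (t * t - t) * (a + b) <=
    X * (t * t - t + d * (1 / 2 - t + t * t)) + U * (d * (t * t) / 2) by nra.
have e3 : U * (d * (t * t) / 2) <= X * (d * (t * t) / 2).
  by rewrite ler_wpM2r // divr_ge0 // mulr_ge0 ?mulr_ge0 // ltW //; lra.
(* With t^2 = 1 - 2t the left side is 1 - 3t + d (2 - 4t). Multiplied by 1 + t it becomes (d (1 + t)
   - 1)(2 - 4t), because (3t - 1)(1 + t) = 2 - 4t. *)
have e4 : t * t - t + d * (1 / 2 - t + t * t) + d * (t * t) / 2 < 0.
  have : (d * (1 + t) - 1) * (2 - 4 * t) < 0 by rewrite pmulr_llt0; lra.
  rewrite t2; nra.
have := mulr_gt0 X_gt0 (_ : 0 < - (t * t - t + d * (1 / 2 - t + t * t) + d * (t * t) / 2)).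
rewrite oppr_gt0 => /(_ e4); nra.
Qed.

(** If the head x of z on its k largest entries outweighs the tail v, then the tail has entries at
    most alpha and sum at most k alpha. Hence some k-sparse u with entries 0 or of size alpha
    satisfies g.u <= g.v, so <Ax, A(x + u)> <= <Ax, Az> = 0, and |u|_2 <= |x|_2. This forces x =
    0. *)
Lemma weak_NSP_of_RIP {R : realType} {m n} (A : 'M[R]_(m, n)) k d :
  RIP A (2 * k) d -> d < 1 / Num.sqrt 2 -> weak_NSP A k.
Proof.
move=> rip d_lt z Az S0 S0k.
have [S [tau [_ Sk Smax [tau0 tauS tauC tauk]]]] := top_coordinates k finset.setT z.
have S0S : l1norm_on S0 z <= l1norm_on S z by apply: Smax; rewrite ?finset.subsetT.
suff SC : l1norm_on S z <= l1norm_on (~: S)%SET z.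
  by have := l1norm_split S z; rewrite (l1norm_split S0 z); lra.
rewrite leNgt; apply/negP => CS.
have k_gt0 : 0 < k%:R :> R.
  rewrite ltr0n lt0n; apply/negP => /eqP k0; move: Sk CS; rewrite k0 leqn0 cards_eq0.
  by move=> /eqP ->; rewrite /l1norm_on big_set0 ltNge sumr_ge0.
(* The average is taken over k, not over |S|; [tauk] still gives tau <= alpha when |S| < k. *)
pose alpha := l1norm_on S z / k%:R.
have kalpha : k%:R * alpha = l1norm_on S z by rewrite mulrC divfK // gt_eqF.
have tau_alpha : tau <= alpha.
  rewrite ler_pdivlMr // tauk mulr_natr -sumr_const; exact: ler_sum.
have alpha0 : 0 <= alpha := le_trans tau0 tau_alpha.
pose x := \col_i (if i \in S then z i 0 else 0).
have xS i : i \notin S -> x i 0 = 0 by move=> /negPf iS; rewrite mxE iS.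
pose v := z - x.
have vE i : v i 0 = if i \in S then 0 else z i 0.
  by rewrite !mxE; case: ifP => _; rewrite ?subrr ?subr0.
pose g := A^T *m (A *m x).
have [T [TC Tk Tg]] := sum_top_coordinates k (~: S)%SET g.
pose u := \col_i (if i \in T then - alpha * Num.sg (g i 0) else 0).
have uT i : i \notin T -> u i 0 = 0 by move=> /negPf iT; rewrite mxE iT.
have dST i : i \in S -> i \notin T.
  by move=> iS; apply/negP => /(fintype.subsetP TC); rewrite inE iS.
have gu : dotv g u = - (alpha * l1norm_on T g).
  rewrite dotvE (bigID (mem T)) /= addrC big1 => [|i iT]; last by rewrite uT // mulr0.
  rewrite add0r /l1norm_on mulr_sumr -sumrN; apply: eq_bigr => i iT.
  by rewrite [u i 0]mxE iT mulrCA mulNr [`|_|]normrEsg [_ * Num.sg _]mulrC.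
have gv : - dotv g v <= alpha * l1norm_on T g.
  apply: le_trans (Tg alpha v _ _).
  - rewrite dotvE (bigID (mem S)) /= big1 => [|i iS]; last by rewrite vE iS mulr0.
    rewrite add0r -sumrN [leRHS](eq_bigl (fun i => i \notin S)) => [|i]; last by rewrite inE.
    by apply: ler_sum => i _; rewrite -normrM -normrN ler_norm.
  - move=> i; rewrite inE vE => iS; rewrite (negPf iS).
    by apply: le_trans tau_alpha; apply: tauC; rewrite ?inE.
  - rewrite kalpha; apply: le_trans (ltW CS); rewrite le_eqVlt; apply/orP; left; apply/eqP.
    by apply: eq_bigr => i; rewrite inE vE => /negPf ->.
have card_le (W : {set 'I_n}) (c : R) : (#|W| <= k)%N -> 0 <= c ->
    \sum_(i in W) c <= k%:R * c.
  by move=> Wk c0; rewrite sumr_const -[c *+ _]mulr_natl ler_wpM2r // ler_nat.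
have uu : dotv u u <= k%:R * alpha ^+ 2.
  rewrite dotvE (bigID (mem T)) /= addrC big1 => [|i iT]; last by rewrite uT // mulr0.
  rewrite add0r; apply: le_trans (card_le T _ Tk (sqr_ge0 alpha)).
  apply: ler_sum => i iT; rewrite mxE iT -expr2 exprMn sqrrN sqr_sg.
  by rewrite ler_piMr ?sqr_ge0 // lern1 leq_b1.
(* Cauchy-Schwarz for [x] against its sign vector, whose square is at most k. *)
have xx : k%:R * alpha ^+ 2 <= dotv x x.
  pose s := \col_i (if i \in S then Num.sg (z i 0) else 0).
  have xs : dotv x s = l1norm_on S z.
    rewrite dotvE (bigID (mem S)) /= addrC big1 => [|i iS]; last by rewrite xS // mul0r.
    rewrite add0r; apply: eq_bigr => i iS; rewrite !mxE iS [RHS]normrEsg.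
    exact: mulrC.
  have ss : dotv s s <= k%:R.
    rewrite dotvE (bigID (mem S)) /= addrC big1 => [|i /negPf iS]; last first.
      by rewrite !mxE iS mulr0.
    rewrite add0r -[leRHS]mulr1; apply: le_trans (card_le S _ Sk ler01).
    by apply: ler_sum => i iS; rewrite !mxE iS -expr2 sqr_sg lern1 leq_b1.
  have : l1norm_on S z ^+ 2 <= dotv x x * dotv s s.
    rewrite -!sqr_l2norm -exprMn lerXn2r ?nnegrE ?mulr_ge0 ?l2norm_ge0 //.
      exact: l1norm_on_ge0.
    by rewrite -xs cauchy_schwarz.
  rewrite -kalpha exprMn => h.
  rewrite -(ler_pM2l k_gt0) mulrA -expr2; apply: le_trans h _.
  by rewrite mulrC ler_wpM2r // dotvv_ge0.
have gxv : dotv g x + dotv g v = 0.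
  by rewrite -dotvDr /v addrC subrK /g -dotv_mulmx Az dotv0r.
have x0 : x = 0.
  apply: (RIP_inner_le0 A k d S T x u rip d_lt Sk Tk dST xS uT (le_trans uu xx)).
  by rewrite dotv_mulmx -/g dotvDr; move: gu gv gxv; clear; lra.
move: CS; rewrite ltNge => /negP; apply.
suff -> : l1norm_on S z = 0 by exact: l1norm_on_ge0.
rewrite /l1norm_on big1 // => i iS; have /colP/(_ i) := x0.
by rewrite !mxE iS => ->; rewrite normr0.
Qed.

(** * Range space vectors and best k-term approximation *)

(** With the bound 1 non-strict, this is solvability of a finite system of linear inequalities in
    [eta], the form decided by [farkas_affine]. *)
Definition weak_RSP {R : realType} {m n} (A : 'M[R]_(m, n)) (k : nat) : Prop :=
  forall S1 S2 : {set 'I_n}, (S1 :&: S2)%SET = finset.set0 ->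
  (#|S1| + #|S2| <= k)%N ->
  exists eta : 'cV[R]_m,
    [/\ forall i, i \in S1 -> (A^T *m eta) i 0 = 1,
        forall i, i \in S2 -> (A^T *m eta) i 0 = -1
      & forall i, `|(A^T *m eta) i 0| <= 1].

Lemma weak_RSP_of_RSP {R : realType} {m n} (A : 'M[R]_(m, n)) k :
  RSP_tr A k -> weak_RSP A k.
Proof.
move=> rsp S1 S2 S12 S12k; have [z [[eta ->] z1 z2 z3]] := rsp S1 S2 S12 S12k.
exists eta; split=> // i; have [i1|i1] := boolP (i \in S1); first by rewrite z1 // normr1.
have [i2|i2] := boolP (i \in S2); first by rewrite z2 // normrN1.
exact/ltW/z3.
Qed.

(** The system is A^T eta <= dp, - A^T eta <= dn. Multipliers a, b >= 0 put z = a - b in the kernel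
    of A, and a.dp + b.dn is at least |z|_1 outside S1 and S2 minus |z|_1 on them, hence
    nonnegative. *)
Lemma weak_RSP_of_weak_NSP {R : realType} {m n} (A : 'M[R]_(m, n)) k :
  weak_NSP A k -> weak_RSP A k.
Proof.
move=> nsp S1 S2 S12 S12k.
pose dp : 'cV[R]_n := \col_i (if i \in S2 then - 1 else 1).
pose dn : 'cV[R]_n := \col_i (if i \in S1 then - 1 else 1).
have disj i : i \in S1 -> i \in S2 -> False.
  by move=> i1 i2; have := finset.in_set0 i; rewrite -S12 inE i1 i2.
have [l|eta] := farkas_affine (col_mx A^T (- A^T)) (col_mx dp dn).
  rewrite -[l]vsubmxK; move: (usubmx l) (dsubmx l) => a b /vle0_col_mx[a0 b0].
  rewrite tr_col_mx mul_row_col linearN /= trmxK mulNmx -mulmxBr dotv_col_mx => Aab.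
  have := nsp _ Aab (S1 :|: S2)%SET; rewrite cardsU S12 cards0 subn0 => /(_ S12k) nspab.
  have a_ge0 i : 0 <= a i 0 by have := a0 i; rewrite mxE.
  have b_ge0 i : 0 <= b i 0 by have := b0 i; rewrite mxE.
  move: nspab; rewrite -subr_ge0; move=> /le_trans; apply.
  rewrite !dotvE -big_split /= /l1norm_on.
  rewrite [leRHS](bigID (mem (S1 :|: S2)%SET)) /= [leLHS]addrC; apply: lerD.
    rewrite -sumrN; apply: ler_sum => i; rewrite !inE !mxE => /orP[iS|iS].
      have -> : (i \in S2) = false by apply/negP => /(disj i iS).
      rewrite iS; have := ler_norm (a i 0 - b i 0).
      by have := ler_norm (- (a i 0 - b i 0)); rewrite normrN; lra.
    have -> : (i \in S1) = false by apply/negP => /disj /(_ iS).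
    rewrite iS; have := ler_norm (a i 0 - b i 0).
    by have := ler_norm (- (a i 0 - b i 0)); rewrite normrN; lra.
  rewrite (eq_bigl (fun i => i \notin (S1 :|: S2)%SET)) => [|i]; last by rewrite inE.
  apply: ler_sum => i; rewrite !inE !mxE negb_or => /andP[/negPf -> /negPf ->].
  by rewrite !mulr1 ler_norml; have := a_ge0 i; have := b_ge0 i => ? ?; apply/andP; split; lra.
rewrite mul_col_mx mulNmx => /vle_col_mx[h1 h2]; exists eta.
move: (A^T *m eta) h1 h2 => w h1 h2.
have w1 i : w i 0 <= 1.
  by have := h1 i; rewrite !mxE; case: ifP => _ //; lra.
have w2 i : - 1 <= w i 0.
  by have := h2 i; rewrite !mxE; case: ifP => _ //; lra.
split=> [i iS|i iS|i]; last by rewrite ler_norml w1 w2.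
  by apply: le_anti; rewrite w1; have := h2 i; rewrite !mxE iS; lra.
by apply: le_anti; rewrite w2 andbT; have := h1 i; rewrite !mxE iS.
Qed.

(** A k-sparse u with support T leaves at least the part of x outside T, and that part is smallest
    when T carries the k largest entries. *)
Lemma sigma1_attained {R : realType} {n} k (x : 'cV[R]_n) :
  exists2 S : {set 'I_n}, (#|S| <= k)%N & l1norm_on (~: S)%SET x <= sigma1 k x.
Proof.
have [S [_ [_ Sk Smax _]]] := top_coordinates k finset.setT x.
exists S => //; apply: lb_le_inf.
  exists (l1norm (x - 0)), 0 => //=.
  by rewrite /l0norm (eq_card0 (A := _)) // => i; rewrite inE mxE eqxx.
move=> _ [u /= uk <-]; pose T := [set i | u i 0 != 0]%SET.
apply: (@le_trans _ _ (l1norm_on (~: T)%SET x)).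
  have := Smax T; rewrite finset.subsetT => /(_ isT uk).
  by have := l1norm_split S x; rewrite (l1norm_split T x); lra.
rewrite (l1norm_split T (x - u)); apply: (@le_trans _ _ (l1norm_on (~: T)%SET (x - u))).
  rewrite le_eqVlt; apply/orP; left; apply/eqP; apply: eq_bigr => i.
  by rewrite !inE negbK => /eqP u0; rewrite !mxE u0 subr0.
by rewrite lerDr l1norm_on_ge0.
Qed.

Lemma dotv_le_of_dual_norm {R : realType} {q} (phi : 'cV[R]_q -> R) a v :
  is_norm phi -> dual_norm phi a = 1 -> dotv a v <= phi v.
Proof.
move=> [phi_ge0 phi_eq0 phiZ _] a1.
pose D := [set dotv a x | x in unit_ball phi].
(* If the supremum did not exist, its default value 0 would contradict [dual_norm phi a = 1]. *)
have supD : has_sup D.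
  apply: contrapT => nD; have := sup_out nD; rewrite -/(dual_norm phi a) a1.
  by move/eqP; rewrite oner_eq0.
have [v0|v_neq0] := eqVneq (phi v) 0; first by rewrite (phi_eq0 _ v0) dotv0r phi_ge0.
have v_gt0 : 0 < phi v by rewrite lt_def v_neq0 phi_ge0.
have : dotv a ((phi v)^-1 *: v) <= sup D.
  apply: ub_le_sup; first by case: supD.
  exists ((phi v)^-1 *: v) => //; rewrite /unit_ball /= phiZ.
  by rewrite gtr0_norm ?invr_gt0 // mulVf.
by rewrite -/(dual_norm phi a) a1 dotvZr mulrC ler_pdivrMr // mul1r.
Qed.

(** * Optimal solutions and linear programming duality *)

Lemma l1_lipschitz_le {R : realType} {n} (f : 'cV[R]_n -> R) (C : R) :
  (forall x z, f x <= f z + C * l1norm (x - z)) -> l1_lipschitz f.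
Proof.
move=> h; exists C => x z; have h1 := h x z; have := h z x.
by rewrite -opprB l1normN ler_norml => ?; apply/andP; split; lra.
Qed.

Lemma l1norm_mulmx_le {R : realType} {m n} (B : 'M[R]_(m, n)) (x : 'cV[R]_n) :
  l1norm (B *m x) <= (\sum_i \sum_j `|B i j|) * l1norm x.
Proof.
rewrite mulr_suml; apply: ler_sum => i _; rewrite mxE mulr_suml.
apply: le_trans (ler_norm_sum _ _ _) _; apply: ler_sum => j _.
by rewrite normrM ler_wpM2l // normr_le_l1norm.
Qed.

Lemma sum_basis {R : realType} {n} (u : 'cV[R]_n) : u = \sum_i u i 0 *: e_ i.
Proof.
apply/colP => j; rewrite summxE (bigD1 j) //= !mxE !eqxx mulr1 big1 ?addr0 // => i.
by rewrite eq_sym => /negPf ij; rewrite !mxE ij mulr0.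
Qed.

Lemma norm_le_l1norm {R : realType} {q} (phi : 'cV[R]_q -> R) u :
  is_norm phi -> (forall i, phi (e_ i) = 1) -> phi u <= l1norm u.
Proof.
move=> [phi_ge0 _ phiZ phiD] phi1; rewrite {1}[u]sum_basis /l1norm.
elim/big_ind2 : _ => [|x a z b xa zb|i _]; last by rewrite phiZ phi1 mulr1.
  by rewrite -(scale0r 0) phiZ normr0 mul0r.
by apply: le_trans (phiD _ _) _; exact: lerD.
Qed.

Lemma l1_lipschitz_objective {R : realType} {m n q} (A : 'M[R]_(m, n))
    (M : 'M[R]_(m, q)) y phi :
  is_norm phi -> (forall i, phi (e_ i) = 1) -> l1_lipschitz (objective A M y phi).
Proof.
move=> phi_norm phi1; have [_ _ _ phiD] := phi_norm.
apply: l1_lipschitz_le => x z; rewrite /objective.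
have -> : M^T *m (A *m x - y) = M^T *m (A *m z - y) + (M^T *m A) *m (x - z).
  rewrite -mulmxA -mulmxDr; congr (_ *m _).
  by rewrite mulmxBr [RHS]addrC addrA subrK.
apply: le_trans (phiD _ _) _; rewrite lerD2l.
exact: le_trans (norm_le_l1norm _ _ phi_norm phi1) (l1norm_mulmx_le _ _).
Qed.

Lemma optimal_solution_exists {R : realType} {m n q} (A : 'M[R]_(m, n))
    (M : 'M[R]_(m, q)) y mu phi :
  0 <= mu -> is_norm phi -> (forall i, phi (e_ i) = 1) ->
  exists x, optimal_solution A M y mu phi x.
Proof.
move=> mu0 phi_norm phi1.
have [||//||c Kc cmin] := attains_min [set x | l1norm x <= mu] (objective A M y phi) mu.
- by exists 0; rewrite /= l1norm0.
- exact: closed_sublevel l1_lipschitz_l1norm.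
- exact: l1_lipschitz_objective.
by exists c; split.
Qed.

Lemma optimal_valueE {R : realType} {m n q} (A : 'M[R]_(m, n))
    (M : 'M[R]_(m, q)) y mu phi x :
  optimal_solution A M y mu phi x -> optimal_value A M y mu phi = objective A M y phi x.
Proof.
move=> [fx xmin]; apply: le_anti; apply/andP; split.
  by apply: ge_inf; [exists (objective A M y phi x) => _ [z fz <-]; exact: xmin|exists x].
by apply: lb_le_inf; [exists (objective A M y phi x), x|move=> _ [z fz <-]; exact: xmin].
Qed.

(** The Hausdorff distance only controls an infimum. The set of optimal solutions is closed, so the
    infimum is attained and [delta] itself is a valid bound. *)
Lemma closest_optimal_solution {R : realType} {m n q} (A : 'M[R]_(m, n))
    (M : 'M[R]_(m, q)) y mu phi (V : set 'cV[R]_n) (delta : R) v :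
  0 <= mu -> is_norm phi -> (forall i, phi (e_ i) = 1) ->
  (hausdorff_dist (Lambda_opt A M y mu phi) V <= delta%:E)%E -> V v ->
  exists2 x, optimal_solution A M y mu phi x & l2norm (v - x) <= delta.
Proof.
move=> mu0 phi_norm phi1 dist_le Vv.
have [x0 x0opt] := optimal_solution_exists A M y mu phi mu0 phi_norm phi1.
have optE := optimal_valueE _ _ _ _ _ _ x0opt.
have [||x [xmu xopt] xmin] := attains_dist (Lambda_opt A M y mu phi) v.
- by exists x0; split; [exact: x0opt.1|rewrite optE].
- apply: closedI; apply: closed_sublevel; first exact: l1_lipschitz_l1norm.
  exact: l1_lipschitz_objective.
exists x; first by split=> // z fz; rewrite (le_trans xopt) // optE; exact: x0opt.2.
rewrite -lee_fin; apply: le_trans dist_le.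
rewrite /hausdorff_dist le_max; apply/orP; right.
apply: le_trans (ereal_sup_ubound _); last by exists v.
apply: le_ereal_inf_tmp => _ [u Lu <-]; rewrite lee_fin.
by rewrite (l2norm_distC u v) xmin.
Qed.

(** The primal program minimizes s >= 0 subject to B x - b <= s and |x|_1 <= mu. The dual variables
    are the row weights [w] and the multiplier [t] of the norm constraint; the sign constraint on s
    turns a total weight equal to 1 into at most 1. *)
Lemma weak_duality {R : realType} {p n} (B : 'M[R]_(p, n)) (b : 'cV[R]_p)
    (mu s t : R) x w :
  l1norm x <= mu -> 0 <= s -> (forall i, (B *m x - b) i 0 <= s) ->
  vle 0 w -> \sum_i w i 0 <= 1 -> 0 <= t -> (forall i, `|(B^T *m w) i 0| <= t) ->
  - (mu * t + dotv b w) <= s.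
Proof.
move=> xmu s0 Bx w0 w1 t0 Bw.
have h1 : dotv w (B *m x - b) <= s.
  apply: (@le_trans _ _ (dotv w (const_mx s))).
    by apply: dotv_le => // i; rewrite [leRHS]mxE.
  rewrite dotvE (eq_bigr (fun i => w i 0 * s)) => [|i _]; last by rewrite mxE.
  by rewrite -mulr_suml ler_piMl.
have := dotv_le_l1norm _ x _ Bw; rewrite ler_norml => /andP[h2 _].
have h3 := ler_wpM2l t0 xmu.
move: h1; rewrite dotvDr dotvNr dotv_mulmx (dotvC w b); lra.
Qed.

(** The dual conditions with value at least rho form a linear system in (w, t). The sign condition
    of [farkas_affine] reads rho l6 <= l3, where l6 belongs to the value row: it is immediate for l6
    = 0, and otherwise the multipliers divided by l6 are a primal point at level l3 / l6. *)
Lemma strong_duality {R : realType} {p n} (B : 'M[R]_(p, n)) (b : 'cV[R]_p)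
    (mu rho : R) :
  (forall x (s : R), l1norm x <= mu -> 0 <= s -> (forall i, (B *m x - b) i 0 <= s) ->
    rho <= s) ->
  exists w (t : R), [/\ vle 0 w, \sum_i w i 0 <= 1, 0 <= t,
    forall i, `|(B^T *m w) i 0| <= t & mu * t + dotv b w <= - rho].
Proof.
move=> rho_le.
pose e1 k : 'cV[R]_k := const_mx 1.
pose N := col_mx (row_mx (- 1%:M) (0 : 'M[R]_(p, 1)))
  (col_mx (row_mx (0 : 'M[R]_(1, p)) (- 1%:M))
  (col_mx (row_mx (e1 p)^T 0)
  (col_mx (row_mx B^T (- e1 n))
  (col_mx (row_mx (- B^T) (- e1 n))
          (row_mx b^T mu%:M))))).
pose d : 'cV[R]_(p + (1 + (1 + (n + (n + 1))))) :=
  col_mx 0 (col_mx 0 (col_mx 1%:M (col_mx 0 (col_mx 0 (- rho%:M))))).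
have dot1 k (u : 'cV[R]_k) : dotv (e1 k) u = \sum_i u i 0.
  by rewrite dotvE; apply: eq_bigr => i _; rewrite mxE mul1r.
have [l|z] := farkas_affine N d.
  rewrite -[l]vsubmxK; move: (usubmx l) (dsubmx l) => l1 {}l.
  rewrite -[l]vsubmxK; move: (usubmx l) (dsubmx l) => l2 {}l.
  rewrite -[l]vsubmxK; move: (usubmx l) (dsubmx l) => l3 {}l.
  rewrite -[l]vsubmxK; move: (usubmx l) (dsubmx l) => l4 {}l.
  rewrite -[l]vsubmxK; move: (usubmx l) (dsubmx l) => l5 l6.
  move=> /vle0_col_mx[p1 /vle0_col_mx[p2 /vle0_col_mx[p3]]].
  move=> /vle0_col_mx[p4 /vle0_col_mx[p5 p6]].
  rewrite /N !tr_col_mx !mul_row_col !tr_row_mx !mul_col_mx !add_col_mx => Nl.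
  have ew := congr1 usubmx Nl; have et := congr1 dsubmx Nl; clear Nl.
  rewrite col_mxKu !linear0 !(linearN trmx) /= !trmxK trmx1 in ew.
  rewrite col_mxKd !linear0 !(linearN trmx) /= !tr_scalar_mx in et.
  rewrite !(mulNmx, mul0mx, mul1mx, add0r) in ew et.
  have {}et : - l2 0 0 - dotv (e1 n) l4 - dotv (e1 n) l5 + mu * l6 0 0 = 0.
    have := congr1 (fun v : 'cV[R]_1 => v 0 0) et; rewrite mul_scalar_mx.
    rewrite /dotv; move: (_ *m l4) (_ *m l5) => u4 u5; rewrite !mxE => <-.
    by rewrite !addrA.
  have {}ew i : - l1 i 0 + l3 0 0 + (B *m (l4 - l5)) i 0 + b i 0 * l6 0 0 = 0.
    have := congr1 (fun v : 'cV[R]_p => v i 0) ew; rewrite mulmxBr.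
    move: (B *m l4) (B *m l5) => u4 u5; rewrite !mxE !big_ord1 mxE mul1r => <-.
    by rewrite !addrA.
  have dotv1 (u v : 'cV[R]_1) : dotv u v = u 0 0 * v 0 0 by rewrite dotvE big_ord1.
  have -> : dotv (col_mx l1 (col_mx l2 (col_mx l3 (col_mx l4 (col_mx l5 l6))))) d
      = l3 0 0 - rho * l6 0 0.
    rewrite /d !dotv_col_mx !dotv0r !add0r !dotv1 !mxE !eqxx !mulr1n mulr1.
    by rewrite mulrN mulrC.
  have l2_ge0 : 0 <= l2 0 0 by have := p2 0; rewrite mxE.
  have l3_ge0 : 0 <= l3 0 0 by have := p3 0; rewrite mxE.
  have : 0 <= l6 0 0 by have := p6 0; rewrite mxE.
  rewrite le_eqVlt => /predU1P[<-|tau_gt0]; first by rewrite mulr0 subr0.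
  rewrite subr_ge0 -ler_pdivlMr //.
  apply: (rho_le ((l6 0 0)^-1 *: (l5 - l4))) => [||i].
  - rewrite l1normZ gtr0_norm ?invr_gt0 // [leLHS]mulrC ler_pdivrMr //.
    apply: (@le_trans _ _ (dotv (e1 n) l4 + dotv (e1 n) l5)); last by lra.
    rewrite !dot1 -big_split /=; apply: ler_sum => i _.
    have := p4 i; have := p5 i; rewrite !mxE => ? ?.
    by rewrite ler_norml; apply/andP; split; lra.
  - by rewrite divr_ge0 // ltW.
  - rewrite -scalemxAr -(opprB l4 l5) mulmxN; have := ew i; move: (B *m (l4 - l5)) => u.
    rewrite !mxE => ewi; rewrite ler_pdivlMr // mulrBl.
    rewrite mulrAC mulVf ?gt_eqF // mul1r.
    by have := p1 i; rewrite mxE; lra.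
rewrite -[z]vsubmxK; move: (usubmx z) (dsubmx z) => w t.
rewrite /N !mul_col_mx !mul_row_col !(mulNmx, mul0mx, mul1mx, add0r, addr0).
move=> /vle_col_mx[q1 /vle_col_mx[q2 /vle_col_mx[q3]]].
move=> /vle_col_mx[q4 /vle_col_mx[q5 q6]].
exists w, (t 0 0); split.
- by move=> i; have := q1 i; rewrite !mxE oppr_le0.
- by have := q3 0; rewrite -[leLHS]/(dotv (e1 p) w) dot1 mxE eqxx.
- by have := q2 0; rewrite !mxE oppr_le0.
- move=> i; have := q4 i; have := q5 i; move: (B^T *m w) => u.
  rewrite !mxE !big_ord1 !mxE !mul1r => ? ?.
  by rewrite ler_norml; apply/andP; split; lra.
- have := q6 0; rewrite mul_scalar_mx /dotv; move: (b^T *m w) => u.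
  by rewrite !mxE eqxx mulr1n; lra.
Qed.

(** * The primal-dual system *)

(** Primal blocks: a point [x], a bound [t] on its absolute values and the residual level [rho].
    Dual blocks: the parts [u], [v] of a difference, a bound [tau] on their sum and the row weights
    [w]. *)
Definition col7 {R : realType} {n nh} (x t : 'cV[R]_n) (rho : R) (u v : 'cV[R]_n)
    (tau : R) (w : 'cV[R]_nh) :=
  col_mx x (col_mx t (col_mx (rho%:M : 'cV[R]_1)
    (col_mx u (col_mx v (col_mx (tau%:M : 'cV[R]_1) w))))).

Lemma col7_surj {R : realType} {n nh}
    (p : 'cV[R]_(n + (n + (1 + (n + (n + (1 + nh))))))) :
  exists x t rho u v tau w, p = col7 x t rho u v tau w.
Proof.
rewrite -[p]vsubmxK; move: (usubmx p) (dsubmx p) => x {}p.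
rewrite -[p]vsubmxK; move: (usubmx p) (dsubmx p) => t {}p.
rewrite -[p]vsubmxK [usubmx p]mx11_scalar; move: (usubmx p 0 0) (dsubmx p) => rho {}p.
rewrite -[p]vsubmxK; move: (usubmx p) (dsubmx p) => u {}p.
rewrite -[p]vsubmxK; move: (usubmx p) (dsubmx p) => v {}p.
rewrite -[p]vsubmxK [usubmx p]mx11_scalar; move: (usubmx p 0 0) (dsubmx p) => tau w.
by exists x, t, rho, u, v, tau, w.
Qed.

Lemma row7_col7 {R : realType} {n nh r} (B1 B2 : 'M[R]_(r, n)) (B3 : 'M[R]_(r, 1))
    (B4 B5 : 'M[R]_(r, n)) (B6 : 'M[R]_(r, 1)) (B7 : 'M[R]_(r, nh))
    x t rho u v tau w :
  row7 B1 B2 B3 B4 B5 B6 B7 *m col7 x t rho u v tau w =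
  B1 *m x + (B2 *m t + (rho *: B3 + (B4 *m u + (B5 *m v + (tau *: B6 + B7 *m w))))).
Proof. by rewrite /row7 /col7 !mul_row_col !mul_mx_scalar. Qed.

Definition rhs1_hat {R : realType} {m n q nh} (M : 'M[R]_(m, q)) (y : 'cV[R]_m) (mu : R)
    (G : 'M[R]_(q, nh)) :
    'cV[R]_(n + (n + (1 + (nh + (n + (1 + (n + (1 + (n + (n + (1 + nh))))))))))) :=
  col_mx 0 (col_mx 0 (col_mx mu%:M (col_mx ((M *m G)^T *m y) (col_mx 0 (col_mx 1%:M 0))))).

Lemma vle_M1_hat {R : realType} {m n q nh} (A : 'M[R]_(m, n)) (M : 'M[R]_(m, q))
    (y : 'cV[R]_m) (mu : R) (G : 'M[R]_(q, nh)) x t rho u v tau w :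
  vle (M1_hat A M G *m col7 x t rho u v tau w) (rhs1_hat M y mu G) <->
  [/\ forall i, `|x i 0| <= t i 0, \sum_i t i 0 <= mu, 0 <= rho &
    forall s, (((M *m G)^T *m A) *m x - (M *m G)^T *m y) s 0 <= rho] /\
  [/\ vle 0 w, \sum_s w s 0 <= 1, 0 <= tau, vle 0 u /\ vle 0 v &
    forall i, u i 0 + v i 0 <= tau].
Proof.
pose e1 k : 'cV[R]_k := const_mx 1.
have sumE k (z : 'cV[R]_k) : ((e1 k)^T *m z) 0 0 = \sum_i z i 0.
  by rewrite mxE; apply: eq_bigr => i _; rewrite !mxE mul1r.
(* The trailing 0 of [rhs1_hat] is split into one zero block for each of the six sign
   constraints. *)
rewrite /M1_hat /rhs1_hat -(col_mx0 _ n) -(col_mx0 _ 1) -(col_mx0 _ n).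
rewrite -(col_mx0 _ n) -(col_mx0 _ 1).
rewrite !mul_col_mx !row7_col7.
rewrite !(mul0mx, mul1mx, mulNmx, scaler0, add0r, addr0, scalerN).
rewrite !vle_col_mx.
have vle1 (a b : 'cV[R]_1) : vle a b <-> a 0 0 <= b 0 0.
  by split=> [|h i]; [exact|rewrite !ord1].
have vleN k (z : 'cV[R]_k) : vle (- z) 0 <-> vle 0 z.
  by split=> h i; have := h i; rewrite !mxE oppr_le0.
have scal1 (a : R) : (a%:M : 'cV[R]_1) 0 0 = a by rewrite mxE eqxx.
have scalN (a : R) : ((- (a *: 1%:M) : 'cV[R]_1) 0 0 <= (0 : 'cV[R]_1) 0 0) = (0 <= a).
  by rewrite !mxE eqxx mulr1 oppr_le0.
rewrite !vle1 !sumE !vleN !scalN !scal1; move: (_ *m x) (_ *m y) => Bx b.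
split.
  move=> [h1 [h2 [h3 [h4 [h5 [h6 [_ [h8 [h9 [h10 [h11 h12]]]]]]]]]]].
  split; split=> // i.
  - have := h1 i; have := h2 i; rewrite !mxE => ? ?.
    by rewrite ler_norml; apply/andP; split; lra.
  - by have := h4 i; rewrite !mxE; lra.
  - by have := h5 i; rewrite !mxE; lra.
move=> [[h1 h2 h3 h4] [h5 h6 h7 [h8 h9] h10]].
have hx i := ler_norm (x i 0); have hNx i := ler_norm (- x i 0).
have t0 i := le_trans (normr_ge0 _) (h1 i).
do ![split=> //] => i; rewrite ?mxE //.
- by have := h1 i; have := hx i; lra.
- by have := h1 i; have := hNx i; rewrite normrN; lra.
- by have := h4 i; rewrite !mxE; lra.
- by have := h10 i; lra.
Qed.

Lemma M2_hatE {R : realType} {m n q nh} (A : 'M[R]_(m, n)) (M : 'M[R]_(m, q))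
    (y : 'cV[R]_m) (mu : R) (G : 'M[R]_(q, nh)) x t rho u v tau w :
  M2_hat A M y mu G *m col7 x t rho u v tau w =
  col_mx (u - v + ((M *m G)^T *m A)^T *m w)
         ((rho + mu * tau + dotv ((M *m G)^T *m y) w)%:M : 'cV[R]_1).
Proof.
rewrite /M2_hat mul_col_mx !row7_col7.
rewrite !(mul0mx, mul1mx, mulNmx, scaler0, add0r, addr0).
congr col_mx; first by rewrite addrA trmx_mul trmxK mulmxA.
rewrite scalemx1 scale_scalar_mx addrA !raddfD /= (mulrC tau); congr (_ + _).
by rewrite [LHS]mx11_scalar /dotv trmx_mul trmxK mulmxA.
Qed.

(** * Dual multipliers and the constant [c] *)

(** Each coordinate of [h] uses the column e_i or -e_i according to its sign. Building [w] as a sum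
    of unit vectors keeps the total weight correct without asking whether [s] is injective. *)
Lemma nonneg_combination {R : realType} {q nh} (G : 'M[R]_(q, nh)) (h : 'cV[R]_q) :
  signed_basis `<=` range (fun s => col s G) ->
  exists w, [/\ vle 0 w, \sum_s w s 0 = l1norm h & G *m w = h].
Proof.
move=> cover; have /choice[s sP] (i : 'I_q) : exists s, `|h i 0| *: col s G = h i 0 *: e_ i.
  have [h0|h0] := leP 0 (h i 0).
    have [s _ Gs] : range (fun s => col s G) (e_ i) by apply: cover; exists i; left.
    by exists s; rewrite Gs ger0_norm.
  have [s _ Gs] : range (fun s => col s G) (- e_ i) by apply: cover; exists i; right.
  by exists s; rewrite Gs ltr0_norm // scalerN scaleNr opprK.
exists (\sum_i `|h i 0| *: e_ (s i)); split.
- move=> j; rewrite summxE mxE; apply: sumr_ge0 => i _.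
  by rewrite !mxE mulr_ge0 // ler0n.
- under eq_bigr do rewrite summxE.
  rewrite exchange_big /=; apply: eq_bigr => i _.
  rewrite (bigD1 (s i)) //= !mxE !eqxx mulr1 big1 ?addr0 // => j /negPf ji.
  by rewrite !mxE ji mulr0.
- rewrite mulmx_sumr [RHS]sum_basis; apply: eq_bigr => i _.
  by rewrite -scalemxAr -colE sP.
Qed.

Lemma gram_unit {R : realType} {m n} (A : 'M[R]_(m, n)) :
  \rank A = m -> A *m A^T \in unitmx.
Proof.
move=> rankA; rewrite -row_free_unit; apply: inj_row_free => v vAA.
have vA : (v *m A)^T = 0.
  apply: dotvv_eq0; rewrite /dotv trmxK trmx_mul mulmxA -(mulmxA v) vAA mul0mx.
  by rewrite mxE.
have /row_free_inj : row_free A by rewrite /row_free rankA.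
by apply; rewrite mul0mx -[LHS]trmxK vA trmx0.
Qed.

Lemma invertible_columns {R : realType} {m q} (M : 'M[R]_(m, q)) :
  \rank M = m -> exists (G : {set 'I_q}) (hG : #|G| = m), submx_cols M hG \in unitmx.
Proof.
move=> rankM; have full : row_full M^T by rewrite /row_full mxrank_tr rankM.
pose f := fullrankfun full.
pose G := [set f i | i in 'I_m]%SET.
have hG : #|G| = m by rewrite card_imset ?card_ord //; exact: fullrankfun_inj.
exists G, hG; rewrite -unitmx_tr -row_full_unit.
have := row_full_unit (rowsub f M^T); rewrite fullrowsub_unit => fullf.
(* [f] and the increasing enumeration of [G] may list the chosen columns in different orders, so row
   spaces are compared. *)
rewrite -sub1mx; apply: submx_trans (_ : (1%:M <= rowsub f M^T)%MS) _.
  by rewrite sub1mx fullf.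
apply/row_subP => i; have fG : f i \in G by apply/imsetP; exists i.
have -> : row i (rowsub f M^T) =
    row (cast_ord hG (enum_rank_in fG (f i))) (submx_cols M hG)^T.
  apply/rowP => j; rewrite !mxE cast_ordK enum_rankK_in //.
exact: row_sub.
Qed.

Lemma norm_inf_1_ge {R : realType} {m n} (Q : 'M[R]_(m, n)) (x : 'cV[R]_n) :
  (forall i, `|x i 0| <= 1) -> l1norm (Q *m x) <= norm_inf_1 Q.
Proof.
move=> x1; apply: ub_le_sup; last by exists x => //; exact: linfnorm_le.
exists ((\sum_i \sum_j `|Q i j|)) => _ [z /= z1 <-].
rewrite /l1norm; apply: ler_sum => i _; rewrite mxE.
apply: le_trans (ler_norm_sum _ _ _) _; apply: ler_sum => j _.
by rewrite normrM ler_piMr // (le_trans (normr_le_linfnorm _ _)).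
Qed.

Lemma c_const_ge {R : realType} {m n q} (A : 'M[R]_(m, n)) (M : 'M[R]_(m, q))
    (G : {set 'I_q}) (hG : #|G| = m) : submx_cols M hG \in unitmx ->
  norm_inf_1 (invmx (submx_cols M hG) *m invmx (A *m A^T) *m A) <= c_const A M.
Proof.
move=> unitG; apply: ub_le_sup; last by exists G, hG.
pose f (G : {set 'I_q}) := if pselect (#|G| = m) is left hG then
  norm_inf_1 (invmx (submx_cols M hG) *m invmx (A *m A^T) *m A) else 0.
exists (\sum_G `|f G|) => _ [G' [hG' [_ ->]]].
apply: (@le_trans _ _ `|f G'|); last by rewrite (bigD1 G') //= lerDl sumr_ge0.
rewrite /f; case: pselect => // h; rewrite (eq_irrelevance h hG').
exact: ler_norm.
Qed.

(* [h] is supported on an invertible column submatrix of [M]. *)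
Lemma multiplier_lift {R : realType} {m n q} (A : 'M[R]_(m, n)) (M : 'M[R]_(m, q))
    (eta : 'cV[R]_m) :
  \rank A = m -> \rank M = m -> (forall i, `|(A^T *m eta) i 0| <= 1) ->
  exists2 h, M *m h = - eta & l1norm h <= c_const A M.
Proof.
move=> rankA /invertible_columns[G [hG unitG]] zeta1.
pose g j := enum_val (cast_ord (esym hG) j).
pose z := invmx (submx_cols M hG) *m - eta.
exists (colsub g 1%:M *m z).
  rewrite mulmxA mulmx_colsub mulmx1 /z mulmxA mulmxV // mul1mx //.
apply: le_trans (c_const_ge A M G hG unitG).
have -> : z = - (invmx (submx_cols M hG) *m invmx (A *m A^T) *m A *m (A^T *m eta)).
  rewrite /z mulmxN; congr (- _).
  by rewrite -!mulmxA (mulmxA A) (mulmxA (invmx (A *m A^T))) mulVmx ?mul1mx ?gram_unit.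
set Q := _ *m A; have := norm_inf_1_ge Q _ zeta1; rewrite -l1normN.
move: (- (Q *m _)) => u; apply: le_trans.
have -> : colsub g 1%:M *m u = \sum_j u j 0 *: e_ (g j).
  apply/colP => i; rewrite mxE summxE; apply: eq_bigr => j _.
  by rewrite !mxE eqxx andbT mulrC.
rewrite {2}/l1norm.
elim/big_ind2 : _ => [|a s b t sa tb|j _]; first by rewrite l1norm0.
  by apply: le_trans (l1norm_triangle _ _) _; exact: lerD.
rewrite l1normZ /l1norm (bigD1 (g j)) //= mxE !eqxx normr1 big1 ?addr0 ?mulr1 // => i.
by move=> /negPf ij; rewrite mxE ij normr0.
Qed.

(** For an invertible M_G, the matrix Q of [c] satisfies Q A^T = M_G^-1, which is nonzero as m > 0.
    Unit vectors bound each entry of Q by [norm_inf_1 Q], so this norm cannot be 0. *)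
Lemma c_const_gt0 {R : realType} {m n q} (A : 'M[R]_(m, n)) (M : 'M[R]_(m, q)) :
  (0 < m)%N -> \rank A = m -> \rank M = m -> 0 < c_const A M.
Proof.
move=> m_gt0 rankA /invertible_columns[G [hG unitG]].
apply: lt_le_trans (c_const_ge A M G hG unitG).
set Q := _ *m A; have QA : Q *m A^T = invmx (submx_cols M hG).
  by rewrite /Q -mulmxA mulmxKV // gram_unit.
have : Q != 0.
  apply/negP => /eqP Q0; move: QA; rewrite Q0 mul0mx => inv0.
  have := mulmxV unitG; rewrite -inv0 mulmx0 => /matrixP/(_ (Ordinal m_gt0) (Ordinal m_gt0)).
  by rewrite !mxE eqxx => /eqP; rewrite eq_sym oner_eq0.
move=> /eqP Q_neq0; rewrite ltNge; apply/negP => Q_le0; apply: Q_neq0.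
apply/matrixP => i j; rewrite [RHS]mxE; apply/eqP; rewrite -normr_le0.
have := norm_inf_1_ge Q (e_ j) _; rewrite -colE => /(_ _)/(le_trans (normr_le_l1norm _ i)).
rewrite mxE => h; apply: le_trans Q_le0; apply: h => k.
by rewrite mxE; case: (_ && _); rewrite ?normr1 ?normr0.
Qed.

Lemma pos_neg_parts {R : realType} {n} (z : 'cV[R]_n) : exists u v : 'cV[R]_n,
  [/\ vle 0 u, vle 0 v, u - v + z = 0 & forall i, u i 0 + v i 0 = `|z i 0|].
Proof.
exists (\col_i Num.max 0 (- z i 0)), (\col_i Num.max 0 (z i 0)).
split=> [i|i||i]; rewrite ?mxE ?le_max ?lexx //.
  apply/colP => i; rewrite !mxE; have [z0|/ltW z0] := leP 0 (z i 0).
    by rewrite max_l ?oppr_le0 //; ring.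
  by rewrite max_r ?oppr_ge0 //; ring.
have [z0|/ltW z0] := ger0P (z i 0).
  by rewrite max_l ?oppr_le0 // add0r.
by rewrite max_r ?oppr_ge0 // addr0.
Qed.

(** Applied twice: at an optimal primal-dual pair, to show that the polyhedron is nonempty, and at
    the given [x], to measure its residual. *)
Lemma hat_point {R : realType} {m n q nh} (A : 'M[R]_(m, n)) (M : 'M[R]_(m, q))
    (y : 'cV[R]_m) (mu : R) (G : 'M[R]_(q, nh)) x rho tau w :
  l1norm x <= mu -> 0 <= rho ->
  (forall s, (((M *m G)^T *m A) *m x - (M *m G)^T *m y) s 0 <= rho) ->
  vle 0 w -> \sum_s w s 0 <= 1 -> 0 <= tau ->
  (forall i, `|(((M *m G)^T *m A)^T *m w) i 0| <= tau) ->
  exists t u v, let z := col7 x t rho u v tau w in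
    vle (M1_hat A M G *m z) (rhs1_hat M y mu G) /\
    M2_hat A M y mu G *m z =
      col_mx 0 ((rho + mu * tau + dotv ((M *m G)^T *m y) w)%:M : 'cV[R]_1).
Proof.
move=> xmu rho0 xrho w0 w1 tau0 ztau.
have [u [v [u0 v0 uvE uvz]]] := pos_neg_parts (((M *m G)^T *m A)^T *m w).
exists (\col_i `|x i 0|), u, v; split; last by rewrite M2_hatE uvE.
apply/vle_M1_hat; split; split=> //.
- by move=> i; rewrite mxE.
- by rewrite (eq_bigr (fun i => `|x i 0|)) // => i _; rewrite mxE.
- by move=> i; rewrite uvz.
Qed.

(** Compactness gives a primal minimizer, [strong_duality] a dual point of at least its value, and
    [weak_duality] then closes the gap. The 0 in the maximum [g] accounts for the constraint rho >=
    0. *)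
Lemma hat_polyhedron_nonempty {R : realType} {m n q nh} (A : 'M[R]_(m, n))
    (M : 'M[R]_(m, q)) (y : 'cV[R]_m) (mu : R) (G : 'M[R]_(q, nh)) :
  0 <= mu ->
  polyhedron (M1_hat A M G) (M2_hat A M y mu G) (rhs1_hat M y mu G) 0 !=set0.
Proof.
move=> mu0; pose B := (M *m G)^T *m A; pose b := (M *m G)^T *m y.
pose g (x : 'cV[R]_n) := \big[Num.max/0]_s (B *m x - b) s 0.
have g0 x : 0 <= g x by exact: bigmax_ge_id.
have gB x s : (B *m x - b) s 0 <= g x by apply: (le_bigmax_cond _ (fun s => (B *m x - b) s 0)).
have g_lip : l1_lipschitz g.
  apply: l1_lipschitz_le => x z; apply/bigmax_leP; split=> [|s _].
    rewrite addr_ge0 //; apply: le_trans (l1norm_ge0 (B *m (x - z))) _.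
    exact: l1norm_mulmx_le.
  have -> : (B *m x - b) s 0 = (B *m z - b) s 0 + (B *m (x - z)) s 0.
    by rewrite mulmxBr; move: (B *m x) (B *m z) => a1 a2; rewrite !mxE; ring.
  apply: lerD => //; apply: le_trans (ler_norm _) _.
  exact: le_trans (normr_le_l1norm _ _) (l1norm_mulmx_le _ _).
have [||//||x xmu xmin] := attains_min [set x | l1norm x <= mu] g mu.
- by exists 0; rewrite /= l1norm0.
- exact: closed_sublevel l1_lipschitz_l1norm.
- by [].
have [z s zmu s0 Bz|w [tau [w0 w1 tau0 Bw wtau]]] := strong_duality B b mu (g x).
  by apply: le_trans (xmin z zmu) _; apply/bigmax_leP.
have weak := weak_duality B b mu (g x) tau x w xmu (g0 x) (gB x) w0 w1 tau0 Bw.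
have [t [u [v [h1 h2]]]] := hat_point A M y mu G x (g x) tau w xmu (g0 x) (gB x) w0 w1 tau0 Bw.
exists (col7 x t (g x) u v tau w); split=> //; rewrite h2.
have -> : g x + mu * tau + dotv ((M *m G)^T *m y) w = 0.
  by move: wtau weak; rewrite -/b; clear; lra.
by rewrite raddf0 col_mx0.
Qed.

Lemma rowB_objective {R : realType} {m n q nh} (A : 'M[R]_(m, n)) (M : 'M[R]_(m, q))
    (y : 'cV[R]_m) (G : 'M[R]_(q, nh)) x s :
  (((M *m G)^T *m A) *m x - (M *m G)^T *m y) s 0 =
  dotv (col s G) (M^T *m (A *m x - y)).
Proof.
by rewrite -mulmxA -mulmxBr trmx_mul -mulmxA mulmx_dotv -tr_col trmxK.
Qed.

(** [A^T *m eta] is made to agree with the signs of [x] on its k largest entries; elsewhere it loses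
    at most the tail, which is counted once in |x|_1 and once in the pairing. *)
Lemma sum_norm_le_dual {R : realType} {m n} (A : 'M[R]_(m, n)) k (x : 'cV[R]_n) :
  weak_RSP A k -> exists2 eta : 'cV[R]_m, (forall i, `|(A^T *m eta) i 0| <= 1) &
    l1norm x - 2 * sigma1 k x <= dotv (A^T *m eta) x.
Proof.
move=> rsp; have [S Sk Ssigma] := sigma1_attained k x.
pose S1 := [set i in S | 0 < x i 0]%SET; pose S2 := [set i in S | x i 0 < 0]%SET.
have S12 : (S1 :&: S2)%SET = finset.set0.
  by apply/finset.setP => i; rewrite !inE; case: (ltgtP 0 (x i 0)); rewrite ?andbF.
have S12k : (#|S1| + #|S2| <= k)%N.
  apply: leq_trans Sk; have := cardsU S1 S2; rewrite S12 cards0 subn0 => <-.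
  apply: subset_leq_card; apply/fintype.subsetP => i.
  by rewrite !inE => /orP[] /andP[].
have [eta [z1 z2 z3]] := rsp S1 S2 S12 S12k; exists eta => //.
move: (A^T *m eta) z1 z2 z3 => z z1 z2 z3.
have hS : l1norm_on S x <= \sum_(i in S) z i 0 * x i 0.
  apply: ler_sum => i iS; have [xi|xi|->] := ltgtP (x i 0) 0.
  - by rewrite z2 ?inE ?iS // mulN1r ltr0_norm.
  - by rewrite z1 ?inE ?iS // mul1r gtr0_norm.
  - by rewrite normr0 mulr0.
have hC : - l1norm_on (~: S)%SET x <= \sum_(i | i \notin S) z i 0 * x i 0.
  rewrite -sumrN (eq_bigl (fun i => i \notin S)) => [|i]; last by rewrite inE.
  apply: ler_sum => i _; have := ler_norm (- (z i 0 * x i 0)).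
  rewrite normrN normrM => /le_trans/(_ (ler_wpM2r (normr_ge0 _) (z3 i))).
  by rewrite mul1r; lra.
have := l1norm_split S x; rewrite dotvE (bigID (mem S)) /=.
by move: hS hC Ssigma; clear; lra.
Qed.

(** With zeta = A^T eta, tau = 1/c and M G w = - eta / c, the left side is (mu - eta.y) / c. For r =
    M^T(Ax - y), total weight at most 1 gives (zeta.x - eta.y) / c = - r.(G w) <= phi(r), and zeta.x
    >= |x|_1 - 2 sigma_k(x) eliminates eta. *)
Lemma dual_certificate {R : realType} {m n q nh} (A : 'M[R]_(m, n)) (M : 'M[R]_(m, q))
    (y : 'cV[R]_m) (mu : R) (phi : 'cV[R]_q -> R) (G : 'M[R]_(q, nh)) k (x : 'cV[R]_n) :
  (0 < m)%N -> \rank A = m -> \rank M = m -> is_norm phi ->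
  signed_basis `<=` range (fun s => col s G) ->
  (forall s v, dotv (col s G) v <= phi v) -> weak_RSP A k ->
  exists w tau, [/\ vle 0 w, \sum_s w s 0 <= 1, 0 <= tau,
    forall i, `|(((M *m G)^T *m A)^T *m w) i 0| <= tau &
    mu * tau + dotv ((M *m G)^T *m y) w <=
      objective A M y phi x + (mu - l1norm x + 2 * sigma1 k x) / c_const A M].
Proof.
move=> m_gt0 rankA rankM phi_norm cover Gphi rsp.
set c := c_const A M; have c_gt0 : 0 < c by exact: c_const_gt0.
have [eta zeta1 zx] := sum_norm_le_dual A k x rsp.
have [h Mh hc] := multiplier_lift A M eta rankA rankM zeta1.
have [w' [w'0 w'1 Gw']] := nonneg_combination G h cover.
pose w := c^-1 *: w'.
have Gw : G *m w = c^-1 *: h by rewrite -scalemxAr Gw'.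
have MGw : M *m G *m w = - (c^-1 *: eta).
  by rewrite -mulmxA Gw -scalemxAr Mh scalerN.
have w0 : vle 0 w.
  by move=> i; have := w'0 i; rewrite !mxE => ?; rewrite mulr_ge0 // invr_ge0 ltW.
have w1 : \sum_s w s 0 <= 1.
  under eq_bigr do rewrite mxE.
  by rewrite -mulr_sumr w'1 mulrC ler_pdivrMr // mul1r.
exists w, c^-1; split=> //.
- by rewrite invr_ge0 ltW.
- move=> i; rewrite trmx_mul trmxK -mulmxA MGw mulmxN -scalemxAr.
  move: (A^T *m eta) zeta1 => z z1; rewrite !mxE normrN normrM.
  by rewrite gtr0_norm ?invr_gt0 // ler_piMr // invr_ge0 ltW.
rewrite dotvC dotv_mulmx trmxK MGw dotvNl dotvZl.
set r := M^T *m (A *m x - y).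
have Gr : - dotv r (G *m w) <= phi r.
  have phiN : phi (- r) = phi r.
    by have [_ _ phiZ _] := phi_norm; rewrite -scaleN1r phiZ normrN1 mul1r.
  rewrite -dotvNl dotvC -phiN; move: (- r) => r'.
  have phi_ge0 : 0 <= phi r' by have [] := phi_norm.
  rewrite dotvC dotv_mulmx dotvC; apply: (@le_trans _ _ (dotv w (const_mx (phi r')))).
    apply: dotv_le => // s; rewrite [leRHS]mxE mulmx_dotv -tr_col trmxK; exact: Gphi.
  rewrite dotvE (eq_bigr (fun s => w s 0 * phi r')) => [|s _]; last first.
    by rewrite [const_mx _ _ _]mxE.
  by rewrite -mulr_suml ler_piMl.
have rE : - dotv r (G *m w) = c^-1 * (dotv (A^T *m eta) x - dotv eta y).
  rewrite /r -dotv_mulmx mulmxA MGw dotvNr opprK dotvZr; congr (_ * _).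
  by rewrite dotvDl dotvNl (dotvC y) (dotvC (A *m x)) dotv_mulmx.
have cV0 : 0 <= c^-1 by rewrite invr_ge0 ltW.
have := ler_wpM2l cV0 zx; move: Gr; rewrite rE /objective -/r -/c.
by move: (dotv (A^T *m eta) x) (dotv eta y) => Z Y; clear; lra.
Qed.

(** * The error bound *)

Lemma weak_stability {R : realType} {m n q nh} (A : 'M[R]_(m, n)) (M : 'M[R]_(m, q))
    (y : 'cV[R]_m) (mu : R) (phi : 'cV[R]_q -> R) (G : 'M[R]_(q, nh)) (Y : set 'cV[R]_q)
    (delta : R) k (x : 'cV[R]_n) :
  (0 < m)%N -> \rank A = m -> \rank M = m -> 0 <= mu -> is_norm phi ->
  (forall i, phi (e_ i) = 1) -> range (fun s => col s G) = Y -> signed_basis `<=` Y ->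
  (forall a v, Y a -> dotv a v <= phi v) -> weak_RSP A k ->
  (hausdorff_dist (Lambda_opt A M y mu phi) (Lambda_relaxed A M y mu phi Y)
    <= delta%:E)%E ->
  l1norm x <= mu ->
  exists2 xs, optimal_solution A M y mu phi xs &
    l2norm (x - xs) <= delta + gamma_hat A M y mu G *
      (2 * objective A M y phi x + (mu - l1norm x + 2 * sigma1 k x) / c_const A M).
Proof.
move=> m_gt0 rankA rankM mu0 phi_norm phi1 GY cover Yphi rsp dist_le xmu.
have Gphi s v : dotv (col s G) v <= phi v by apply: Yphi; rewrite -GY; exists s.
have phi_ge0 : forall v, 0 <= phi v by have [] := phi_norm.
have rows (z : 'cV[R]_n) s :
    (((M *m G)^T *m A) *m z - (M *m G)^T *m y) s 0 <= objective A M y phi z.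
  by rewrite rowB_objective; exact: Gphi.
have [|w [tau [w0 w1 tau0 Bw bound]]] :=
  dual_certificate A M y mu phi G k x m_gt0 rankA rankM phi_norm _ Gphi rsp.
  by rewrite GY.
have obj0 : 0 <= objective A M y phi x := phi_ge0 _.
have res0 := weak_duality _ _ mu _ tau x w xmu obj0 (rows x) w0 w1 tau0 Bw.
have [t [u [v [h1 h2]]]] :=
  hat_point A M y mu G x _ tau w xmu obj0 (rows x) w0 w1 tau0 Bw.
set z := col7 _ _ _ _ _ _ _ in h1 h2.
have [p [p1 p2] zp] := robinson_error_bound _ _ _ _ z
  (hat_polyhedron_nonempty A M y mu G mu0).
move: zp p1 p2; have [x' [t' [rho' [u' [v' [tau' [w' ->]]]]]]] := col7_surj p.
move=> zp /vle_M1_hat[[xt' t'mu rho'0 xrho'] [w'0 w'1 tau'0 [u'0 v'0] uv']].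
rewrite M2_hatE => p2; have uvE := congr1 usubmx p2; have gapE := congr1 dsubmx p2.
rewrite col_mxKu linear0 in uvE; rewrite col_mxKd linear0 in gapE.
have gap0 : rho' + mu * tau' + dotv ((M *m G)^T *m y) w' = 0.
  by have := congr1 (fun a : 'cV[R]_1 => a 0 0) gapE; rewrite !mxE eqxx mulr1n.
clear p2 gapE.
have x'mu : l1norm x' <= mu by apply: le_trans t'mu; exact: ler_sum.
have Bw' i : `|(((M *m G)^T *m A)^T *m w') i 0| <= tau'.
  have /colP/(_ i) := uvE; have := u'0 i; have := v'0 i; have := uv' i.
  move: (_^T *m w') => a; rewrite !mxE => ? ? ? ?.
  by rewrite ler_norml; apply/andP; split; lra.
(* The optimal value of (L) does not occur in the polyhedron. It enters here: an optimal solution of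
   (L) is feasible for the linear program at the level of its objective, so weak duality and the
   zero gap give rho' <= optimal value, which puts x' in the relaxed set. *)
have [x0 x0opt] := optimal_solution_exists A M y mu phi mu0 phi_norm phi1.
have gap := weak_duality _ _ mu _ tau' x0 w' x0opt.1 (phi_ge0 _) (rows x0) w'0 w'1 tau'0 Bw'.
have x'relaxed : Lambda_relaxed A M y mu phi Y x'.
  split=> // a; rewrite -GY => -[s _ <-]; rewrite -rowB_objective.
  apply: le_trans (xrho' s) _; rewrite (optimal_valueE _ _ _ _ _ _ x0opt).
  by move: gap0 gap; clear; rewrite /objective; lra.
have [xs xsopt x'xs] := closest_optimal_solution A M y mu phi _ delta x' mu0 phi_norm phi1
  dist_le x'relaxed.
exists xs => //.
have xx' : l2norm (x - x') <= gamma_hat A M y mu G *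
    (objective A M y phi x + mu * tau + dotv ((M *m G)^T *m y) w).
  apply: (@le_trans _ _ (l2norm (z - col7 x' t' rho' u' v' tau' w'))).
    by rewrite /z /col7 opp_col_mx add_col_mx; exact: l2norm_col_mx_ge.
  apply: le_trans zp _; rewrite /gamma_hat ler_wpM2l ?robinson_sigma_ge0 // subr0 h2.
  rewrite l1norm_col_mx l1norm0 add0r big1 ?add0r => [|i _]; last first.
    rewrite max_l //; have := h1 i; move: (_ *m z) (rhs1_hat _ _ _ _) => a b.
    by rewrite !mxE subr_le0.
  rewrite /l1norm big_ord1 mxE eqxx mulr1n -addrA ger0_norm //.
  by move: res0; clear; lra.
have gamma0 : 0 <= gamma_hat A M y mu G by exact: robinson_sigma_ge0.
have := l2norm_triangle (x - x') (x' - xs); rewrite addrA subrK => /le_trans; apply.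
rewrite addrC; apply: lerD => //; apply: le_trans xx' _; rewrite ler_wpM2l //.
by move: bound; clear; lra.
Qed.

Theorem corollary5p4 (R : realType) (m n q k : nat)
  (A : 'M[R]_(m, n)) (M : 'M[R]_(m, q)) (y : 'cV[R]_m) (mu : R)
  (phi : 'cV[R]_q -> R)
  (m_gt0 : (0 < m)%N) (m_lt_n : (m < n)%N) (m_le_q : (m <= q)%N)
  (rankA : \rank A = m) (rankM : \rank M = m) (mu_gt0 : 0 < mu)
  (phi_norm : is_norm phi)
  (phi_basis : forall i : 'I_q, phi (e_ i) = 1 /\ dual_norm phi (e_ i) = 1)
  (* the polytopes *)
  (chi eps0 : R) (P : R -> set 'cV[R]_q) (eps : nat -> R)
  (chi_gt : expR 1 / (4 * Num.sqrt 2) < chi) (eps0_gt0 : 0 < eps0)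
  (P_barvinok : barvinok_family phi chi eps0 P)
  (eps_seq : tolerance_sequence eps0 eps)
  (* the selected polytope and its matrix of normals *)
  (delta : R) (delta_gt0 : 0 < delta) (j0 : nat) (j0_gt0 : (1 <= j0)%N)
  (j0_close : (hausdorff_dist (Lambda_opt A M y mu phi)
     (Lambda_relaxed A M y mu phi (Q_normals phi P eps j0)) <= delta%:E)%E)
  (nh : nat) (Gamma : 'M[R]_(q, nh))
  (Gamma_cols : enumerates_columns Gamma (Q_normals phi P eps j0))
  (cond :
    (* (a) *) ((1 <= k <= n - 1)%N /\ normalized_columns A /\
               mu1 A k + mu1 A (k - 1) < 1) \/
    (* (b) *) (exists d : R, RIP A (2 * k) d /\ d < 1 / Num.sqrt 2) \/
    (* (c) *) (exists rho : R, stable_NSP A k rho) \/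
    (* (d) *) (exists (nrm : 'cV[R]_m -> R) (rho1 rho2 : R),
                 robust_NSP A k nrm rho1 rho2) \/
    (* (e) *) NSP A k \/
    (* (f) *) RSP_tr A k) :
  let c := c_const A M in
  let gamma := gamma_hat A M y mu Gamma in
  (forall x : 'cV[R]_n, l1norm x < mu ->
     exists xs : 'cV[R]_n, optimal_solution A M y mu phi xs /\
       l2norm (x - xs) <= delta + 2 * gamma *
         (2 * phi (M^T *m (A *m x - y)) +
          (`|mu - l1norm x| + 2 * sigma1 k x) / c)) /\
  (forall x : 'cV[R]_n, l1norm x = mu ->
     exists xs : 'cV[R]_n, optimal_solution A M y mu phi xs /\
       l2norm (x - xs) <= delta + 4 * gamma *
         (phi (M^T *m (A *m x - y)) + sigma1 k x / c)).
Proof.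
move=> c gamma.
have phi1 i : phi (e_ i) = 1 := (phi_basis i).1.
have rsp : weak_RSP A k.
  case: cond => [[kn [An mu1_lt1]]|]; first exact/weak_RSP_of_weak_NSP/weak_NSP_of_coherence.
  case=> [[d [rip d_lt]]|]; first exact/weak_RSP_of_weak_NSP/weak_NSP_of_RIP/d_lt.
  case=> [[rho nsp]|]; first exact/weak_RSP_of_weak_NSP/weak_NSP_of_stable/nsp.
  case=> [[nrm [rho1 [rho2 nsp]]]|].
    exact/weak_RSP_of_weak_NSP/weak_NSP_of_robust/nsp.
  by case=> [/weak_NSP_of_NSP/weak_RSP_of_weak_NSP|/weak_RSP_of_RSP].
have [_ GY] := Gamma_cols.
have phiN v : phi (- v) = phi v.
  by have [_ _ phiZ _] := phi_norm; rewrite -scaleN1r phiZ normrN1 mul1r.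
have Yphi a v : Q_normals phi P eps j0 a -> dotv a v <= phi v.
  have dual_le b u : dual_norm phi b = 1 -> dotv b u <= phi u.
    exact: dotv_le_of_dual_norm.
  case=> [[j [_ [_ a1]]]|[i [->|->]]]; first exact: dual_le.
    exact/dual_le/(phi_basis i).2.
  (* For the normal -e_i the sign is moved to [v], and [phi] is even. *)
  by rewrite dotvNl -dotvNr -phiN; exact/dual_le/(phi_basis i).2.
have stable x : l1norm x <= mu -> _ := weak_stability A M y mu phi Gamma _ delta k x
  m_gt0 rankA rankM (ltW mu_gt0) phi_norm phi1 GY (fun a h => or_intror h) Yphi rsp j0_close.
have gamma0 : 0 <= gamma by exact: robinson_sigma_ge0.
have c_gt0 : 0 < c by exact: c_const_gt0.
have phi_ge0 : forall v, 0 <= phi v by have [] := phi_norm.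
have sigma0 x : 0 <= sigma1 k x :> R.
  have [S _] := sigma1_attained k x; exact: le_trans (l1norm_on_ge0 _ _).
(* [weak_stability] yields the factor gamma; since the bracket is nonnegative, it may be enlarged to
   2 gamma. *)
have weaken (x : 'cV[R]_n) : l1norm x <= mu ->
    gamma * (2 * objective A M y phi x + (mu - l1norm x + 2 * sigma1 k x) / c) <=
    2 * gamma * (2 * objective A M y phi x + (mu - l1norm x + 2 * sigma1 k x) / c).
  move=> xmu; set E := _ + _; have E0 : 0 <= E.
    apply: addr_ge0; first by apply: mulr_ge0 => //; exact: phi_ge0.
    apply: mulr_ge0; last by rewrite invr_ge0 ltW.
    by rewrite addr_ge0 ?subr_ge0 // mulr_ge0.
  by have := mulr_ge0 gamma0 E0; lra.
split=> x xmu.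
  have [xs opt le_xs] := stable x (ltW xmu); exists xs; split=> //.
  apply: le_trans le_xs _; rewrite lerD2l ger0_norm ?subr_ge0 ?(ltW xmu) //.
  exact: weaken (ltW xmu).
have xle : l1norm x <= mu by rewrite xmu.
have [xs opt le_xs] := stable x xle; exists xs; split=> //.
apply: le_trans le_xs _; rewrite lerD2l; apply: le_trans (weaken x xle) _.
rewrite xmu subrr add0r /objective le_eqVlt; apply/orP; left; apply/eqP.
by ring.
Qed.
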